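(* Let $x_1,\ldots,x_n$ be an i.i.d. sample from $f(x;G^* )$, a member of the nonparametric mixture model $\{f(x;G): G\in\mathbb{G}\}$. Suppose that the following conditions are satisfied. (KW1) Identifiability: let $F(x;G)$ be the cumulative distribution function of $f(x;G)$. If $F(x;G)=F(x;G^* )$ for all $x$, then $D_{KW}(G,G^* )=0$. (KW2) Continuity: the component parameter space $\Theta$ is a closed set, and for all $x$ and any given $G_0$, $\lim_{G\to G_0} f(x;G)=f(x;G_0)$. (KW3) Finite Kullback--Leibler information: for any $G\neq G^*$ there exists an $\epsilon>0$ such that $\mathrm{E}^*[\log\{f(X;B_\epsilon(G))/f(X;G^* )\}]^+<\infty$. (KW4) Compactness: the definition of the mixture density $f(x;G)$ in $G$ can be continuously extended to a compact space $\overline{\mathbb{G}}$ while retaining the validity of (KW3). Then the nonparametric MLE $\hat G_n$ is strongly consistent; namely, $D_{KW}(\hat G_n,G^* )\to 0$ almost surely as $n\to\infty$.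
   Context: $\{f(x;\theta):\theta\in\Theta\}$, $\Theta\subset\mathbb{R}^d$, is a family of probability densities with respect to a measure $\mu$. $\mathbb{G}$ is the space of all mixing distributions (c.d.f.s) $G$ on $\Theta$, and $f(x;G)=\int f(x;\theta)\,dG(\theta)$ for $G\in\mathbb{G}$. The distance on $\mathbb{G}$ is $$D_{KW}(G_1,G_2)=\int_\Theta |G_1(\theta)-G_2(\theta)|\exp(-|\theta|)\,d\theta,$$ where $|\theta|=|\theta_1|+\cdots+|\theta_d|$ and $d\theta=d\theta_1\cdots d\theta_d$; $G\to G_0$ means that the distance between $G$ and $G_0$ tends to $0$. $B_\epsilon(G)$ is the open ball of radius $\epsilon$ centred at $G$ (the set of mixing distributions at distance less than $\epsilon$ from $G$; in the extended space, once $\mathbb{G}$ has been extended to $\overline{\mathbb{G}}$), and $f(x;B)=\sup_{G\in B}f(x;G)$ for a set $B$. $\mathrm{E}^*$ is expectation when $X$ has density $f(x;G^* )$, and $[\cdot]^+$ is the positive part. The nonparametric MLE $\hat G_n$ is a c.d.f. on $\Theta$ at which the log-likelihood $\ell_n(G)=\sum_{i=1}^n\log f(x_i;G)$ attains its supremum: $\ell_n(\hat G_n)=\sup\{\ell_n(G):G\in\mathbb{G}\}$.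
   Formalization: Identifiability (KW1) is also required on the compact extended space in (KW4), where the text retains only (KW3); otherwise a limit point other than G* could have the same density as G* and the MLE need not be consistent. The extended space's distance is taken to extend D_KW. *)

(* Defs.v *)
From HB Require Import structures.
From mathcomp Require Import all_boot all_order all_algebra.
From mathcomp Require Import all_classical all_reals all_analysis.

Set Implicit Arguments.
Unset Strict Implicit.
Unset Printing Implicit Defensive.

Import Order.TTheory GRing.Theory Num.Theory.
Import numFieldNormedType.Exports.

Local Open Scope classical_set_scope.
Local Open Scope ring_scope.

(* Lebesgue measure on R^n, with R^n represented by [n.-tuple R] carrying the
   product (= Borel) sigma-algebra: the iterated product of [lebesgue_measure],
   transported along (x, t) |-> x :: t. *)
Section lebesgue_cons.
Context (R : realType) (n : nat)
  (m : {sigma_finite_measure set (n.-tuple R) -> \bar R}).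

Let pairT : measurableType _ := (measurableTypeR R * n.-tuple R)%type.

Let tcons (z : pairT) : n.+1.-tuple R := [tuple of z.1 :: z.2].
Let tuncons (t : n.+1.-tuple R) : pairT := (thead t, [tuple of behead t]).

Let measurable_tcons : measurable_fun setT tcons.
Proof. exact: (@measurable_cons _ _ pairT R fst n snd). Qed.

Let measurable_tuncons : measurable_fun setT tuncons.
Proof.
apply/measurable_fun_pairP; split; last exact: measurable_behead.
exact: (@measurable_tnth _ R n.+1 ord0).
Qed.

Let tconsK : cancel tcons tuncons.
Proof. by case=> x t; rewrite /tcons /tuncons/=; congr pair; apply/val_inj. Qed.

Definition lebesgue_cons : set (n.+1.-tuple R) -> \bar R :=
  pushforward (@lebesgue_measure R \x m)%E
    (fun z : measurableTypeR R * n.-tuple R => [tuple of z.1 :: z.2]).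

HB.instance Definition _ := Measure.copy lebesgue_cons
  (measure_function_pushforward__canonical__measure_function_Measure
     (@lebesgue_measure R \x m)%E measurable_tcons).

Let sigma_finite_lebesgue_cons : sigma_finite setT lebesgue_cons.
Proof.
have /sigma_finiteP[F [FT ndF Foo]] := sigma_finiteT (@lebesgue_measure R).
have /sigma_finiteP[G [GT ndG Goo]] := sigma_finiteT m.
exists (fun i => tuncons @^-1` (F i `*` G i)).
  apply/seteqP; split => // t _.
  have [i _ Fi] : (\bigcup_i F i) (tuncons t).1 by rewrite -FT.
  have [j _ Gj] : (\bigcup_j G j) (tuncons t).2 by rewrite -GT.
  exists (maxn i j) => //; split.
  - by move: Fi; exact/subsetPset/ndF/leq_maxl.
  - by move: Gj; exact/subsetPset/ndG/leq_maxr.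
move=> i; have [mF Fi] := Foo i; have [mG Gi] := Goo i; split.
  rewrite -[X in measurable X]setTI.
  by apply: measurable_tuncons => //; exact: measurableX.
rewrite /lebesgue_cons /pushforward -comp_preimage.
rewrite (_ : _ \o _ = id); last by apply/funext => z; exact: tconsK.
by rewrite preimage_id product_measure1E// lte_mul_pinfty// ge0_fin_numE.
Qed.

HB.instance Definition _ := Measure_isSigmaFinite.Build _ _ _ lebesgue_cons
  sigma_finite_lebesgue_cons.

End lebesgue_cons.

Fixpoint lebesgue_tuple (R : realType) (n : nat) :
    {sigma_finite_measure set (n.-tuple R) -> \bar R} :=
  match n with
  | 0 => \d_([tuple] : 0.-tuple R)
  | n'.+1 => lebesgue_cons (lebesgue_tuple R n')
  end.

Lemma lebesgue_tuple_box (R : realType) (n : nat) (A : 'I_n -> set R) :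
  (forall i, measurable (A i)) ->
  lebesgue_tuple R n [set t | forall i, A i (tnth t i)] =
  (\prod_(i < n) @lebesgue_measure R (A i))%E.
Proof.
elim: n A => [A mA|n IH A mA] /=.
  rewrite big_ord0 diracE (_ : _ \in _ = true)//.
  by apply/mem_set => -[].
rewrite big_ord_recl -IH; last by move=> i; exact: mA.
rewrite /lebesgue_cons /pushforward.
rewrite (_ : _ @^-1` _ =
  A ord0 `*` [set t | forall i, A (lift ord0 i) (tnth t i)]); last first.
  apply/seteqP; split => -[x t]/= => [h|[hx ht] i].
    split; first exact: (h ord0).
    by move=> i; have := h (lift ord0 i); rewrite tnthS.
  by case: (unliftP ord0 i) => [j|] ->//; rewrite tnthS.
rewrite product_measure1E//; first exact: mA.
pose tn i (t : n.-tuple R) := tnth t i.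
suff -> : [set t : n.-tuple R | forall i, A (lift ord0 i) (tnth t i)] =
    \bigcap_(i in [set: 'I_n]) (tn i @^-1` A (lift ord0 i)).
  apply: fin_bigcap_measurable => // i _.
  by rewrite -[X in measurable X]setTI; exact: measurable_tnth.
by apply/seteqP; split => t /= h i; [move=> _; exact: h|exact: (h i I)].
Qed.

Definition orthant (R : realType) (n : nat) (x : n.-tuple R) :
    set (n.-tuple R) :=
  [set y | forall i, tnth y i <= tnth x i].

(* Closedness in the usual topology of R^n, which the library puts on row
   vectors and not on tuples. *)
Definition closed_tuple (R : realType) (n : nat) (A : set (n.-tuple R)) : Prop :=
  closed [set v : 'rV[R]_n | A [tuple v ord0 i | i < n]].

(* A mixing distribution is represented by its probability law on the Borel
   sets of R^d, which is carried by Theta; [mixing_cdf] is its c.d.f. *)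
Definition mixing (R : realType) (d : nat) (Theta : set (d.-tuple R)) : Type :=
  {G : probability (d.-tuple R) R | G Theta = 1%E}.

Section mixture.
Context (R : realType) (k d : nat) (Theta : set (d.-tuple R)).

Definition mixing_law (G : mixing Theta) : probability (d.-tuple R) R :=
  projT1 G.

Definition mixing_cdf (G : mixing Theta) (t : d.-tuple R) : R :=
  fine (mixing_law G (orthant t)).

Definition D_KW (G1 G2 : mixing Theta) : R :=
  \int[lebesgue_tuple R d]_(t in Theta)
    (`|mixing_cdf G1 t - mixing_cdf G2 t| * expR (- \sum_(i < d) `|tnth t i|)).

Definition density_family (mu : {measure set (k.-tuple R) -> \bar R})
    (f : k.-tuple R -> d.-tuple R -> R) : Prop :=
  [/\ measurable_fun ([set: k.-tuple R] `*` Theta) (fun z => f z.1 z.2),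
      forall x t, Theta t -> 0 <= f x t &
      forall t, Theta t -> (\int[mu]_x (f x t)%:E = 1)%E].

(* Extended-real valued, so that no finiteness is built in. *)
Definition mix_density (f : k.-tuple R -> d.-tuple R -> R)
    (x : k.-tuple R) (G : mixing Theta) : \bar R :=
  (\int[mixing_law G]_(t in Theta) (f x t)%:E)%E.

Definition log_likelihood (f : k.-tuple R -> d.-tuple R -> R) (n : nat)
    (x : nat -> k.-tuple R) (G : mixing Theta) : \bar R :=
  (\sum_(i < n) lne (mix_density f (x i) G))%E.

Definition is_NPMLE (f : k.-tuple R -> d.-tuple R -> R) (n : nat)
    (x : nat -> k.-tuple R) (G : mixing Theta) : Prop :=
  log_likelihood f n x G = ereal_sup (range (log_likelihood f n x)).

End mixture.

(* Identifiability and the KL condition are used twice: for the mixing distributions with [D_KW],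
   and for their compact extension with its own distance. Hence an arbitrary
   index type T with a distance [dist], and densities [g x t]. *)
Section conditions.
Context (R : realType) (k : nat) (mu : {measure set (k.-tuple R) -> \bar R}).
Context (T : Type) (dist : T -> T -> R) (g : k.-tuple R -> T -> \bar R).

Definition dist_nbhs (t0 : T) : set_system T :=
  filter_from [set e : R | 0 < e] (fun e => [set t | dist t t0 < e]).

Definition dist_ball (t : T) (e : R) : set T := [set t' | dist t' t < e].

Definition density_cdf (t : T) (x : k.-tuple R) : \bar R :=
  (\int[mu]_(y in orthant x) g y t)%E.

Definition sup_density (x : k.-tuple R) (B : set T) : \bar R :=
  ereal_sup (g x @` B).

(* Expectation when X has density [g ^~ tstar] *)
Definition expect_star (tstar : T) (h : k.-tuple R -> \bar R) : \bar R :=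
  (\int[mu]_x (h x * g x tstar))%E.

Definition identifiable_at (tstar : T) : Prop :=
  forall t, (forall x, density_cdf t x = density_cdf tstar x) ->
    dist t tstar = 0.

Definition continuous_density : Prop :=
  forall x t0, g x @ dist_nbhs t0 --> g x t0.

Definition finite_KL (tstar : T) : Prop :=
  forall t, dist t tstar <> 0 -> exists2 e : R, 0 < e &
    (expect_star tstar
      (fun x => lne (sup_density x (dist_ball t e) / g x tstar))^\+ < +oo)%E.

End conditions.

(* The extended space is a compact metric space; its distance extends [D_KW]
   through the (distance-preserving) map [emb], and [g] extends the mixture
   density. Identifiability is required on the extended space as well:
   a limit point that is not at distance 0 from Gstar may not
   reproduce the distribution of Gstar. *)
Definition compact_extension (R : realType) (k d : nat)
    (mu : {measure set (k.-tuple R) -> \bar R}) (Theta : set (d.-tuple R))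
    (f : k.-tuple R -> d.-tuple R -> R) (Gstar : mixing Theta) : Prop :=
  exists (Gbar : metricType R) (emb : mixing Theta -> Gbar)
      (g : k.-tuple R -> Gbar -> \bar R),
    [/\ compact [set: Gbar],
        forall G1 G2, mdist (emb G1) (emb G2) = D_KW G1 G2,
        forall x G, g x (emb G) = mix_density f x G,
        forall x, continuous (g x) &
        identifiable_at mu (@mdist R Gbar) g (emb Gstar) /\
        finite_KL mu (@mdist R Gbar) g (emb Gstar)].

Definition iid_sample (dO : measure_display) (Omega : measurableType dO)
    (R : realType) (P : probability Omega R) (k : nat)
    (mu : {measure set (k.-tuple R) -> \bar R}) (h : k.-tuple R -> \bar R)
    (X : nat -> {RV P >-> k.-tuple R}) : Prop :=
  (forall i A, measurable A -> P (X i @^-1` A) = \int[mu]_(x in A) h x)%E /\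
  (forall n (A : nat -> set (k.-tuple R)), (forall i, measurable (A i)) ->
    P (\bigcap_(i in `I_n) (X i @^-1` A i)) =
    (\prod_(i < n) P (X i @^-1` A i))%E).

(* Main.v *)
Require Import Defs.
From HB Require Import structures.
From mathcomp Require Import all_boot all_order all_algebra.
From mathcomp Require Import all_classical all_reals all_analysis.
From mathcomp Require Import lra measurable_realfun.

(** Wald's argument. For a point t of the compact extension other than Gstar,
Jensen's inequality (in the form ln u <= 2 (sqrt u - 1)) and identifiability give
E log (g(X, t) / f(X, Gstar)) < 0; by (KW3) and dominated convergence this stays
true for the supremum of g(X, .) over a small ball around t, so by the law of
large numbers the log-likelihood on that ball eventually stays below its value at
Gstar and the NPMLE leaves the ball. Compactness concludes.

Two points need care. The measure mu is arbitrary, so Tonelli cannot be used to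
show that mixture densities have total mass at most 1; instead every mixing
distribution is a D_KW-limit of discrete ones, and Fatou's lemma applies. Only the
upper half of the strong law is needed: partial sums of i.i.d. variables of
negative mean are bounded above almost surely, which follows from the running
maxima M_(n+1) = max (0, X_0 + M_n o shift). *)

Set Implicit Arguments.
Unset Strict Implicit.
Unset Printing Implicit Defensive.

Import Order.TTheory GRing.Theory Num.Theory.
Import numFieldNormedType.Exports.

Local Open Scope classical_set_scope.
Local Open Scope ring_scope.

(** * Discretisation of closed subsets of R^d *)

Section grid.
Context (R : realType) (d : nat).
Implicit Types (t : d.-tuple R) (A : set (d.-tuple R)).

(** Measurability and integrability shape the local argument. A supremum over a ball may fail to be
    measurable; it is replaced by one over a countable family of mixing distributions whose images
    are dense among all images. Only points of the extension adherent to these images need a bound: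
    any other point has a ball that the NPMLE never enters, and adherent points inherit
    nonnegativity, measurability and mass at most 1 as limits of mixture densities. The logarithm of
    g / h, with h the true density, may be -oo, and (KW3) controls only its positive part. Hence the
    numerator g is truncated below at c h for a small c > 0. This can only enlarge the log ratio, so
    a negative mean still suffices, and it bounds the ratio below by ln c, so that dominated
    convergence applies. Jensen's inequality has the slack E (1 - sqrt (g / h))^2, positive by
    identifiability, and c is chosen so that the truncation uses up only part of it. *)

Definition tbox (c : d.-tuple R) (e : R) : set (d.-tuple R) :=
  [set t | forall i, `|tnth c i - tnth t i| < e].

Lemma measurable_tuple_all (A : 'I_d -> set R) :
  (forall i, measurable (A i)) ->
  measurable [set t : d.-tuple R | forall i, A i (tnth t i)].
Proof.
move=> mA.
rewrite (_ : [set _ | _] = \bigcap_(i in [set: 'I_d])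
    ((fun t : d.-tuple R => tnth t i) @^-1` A i)).
  apply: fin_bigcap_measurable => // i _.
  by rewrite -[X in measurable X]setTI; exact: measurable_tnth.
by apply/seteqP; split => t /= h i; [move=> _; exact: h|exact: (h i I)].
Qed.

Lemma measurable_tbox (c : d.-tuple R) e : measurable (tbox c e).
Proof.
rewrite (_ : tbox c e =
    [set t | forall i, [set x | `|tnth c i - x| < e] (tnth t i)])//.
apply: (@measurable_tuple_all (fun i => [set x | `|tnth c i - x| < e])) => i.
rewrite (_ : [set _ | _] = ball (tnth c i) e); first exact: measurable_ball.
by rewrite -ball_normE.
Qed.

Lemma measurable_orthant (c : d.-tuple R) : measurable (orthant c).
Proof.
rewrite (_ : orthant c =
    [set t | forall i, `]-oo, tnth c i]%classic (tnth t i)]).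
  by apply: (@measurable_tuple_all (fun i => `]-oo, tnth c i]%classic)).
by apply/seteqP; split => t /= h i; have := h i; rewrite in_itv.
Qed.

(** Balls of row vectors are taken entrywise, so they are the boxes [tbox]; this carries closedness
    over from row vectors to tuples. *)
Lemma closed_tuple_tbox A t : closed_tuple A ->
  (forall e, 0 < e -> exists2 c, A c & tbox c e t) -> A t.
Proof.
move=> clA h; pose v : 'rV[R]_d := \row_i tnth t i.
have -> : t = [tuple v ord0 i | i < d].
  by apply: eq_from_tnth => i; rewrite tnth_mktuple mxE.
apply: clA => B /nbhs_ballP[e /= e0 eB].
have [c Ac ct] := h e e0.
exists (\row_i tnth c i); split.
  rewrite /= (_ : [tuple _ | _ < _] = c)//.
  by apply: eq_from_tnth => i; rewrite tnth_mktuple mxE.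
apply: eB; split => // i j; rewrite !mxE -ball_normE/= distrC; exact: ct.
Qed.

(** Rational points need not lie in [A], so each box with rational centre and radius 1/(m+1) that
    meets [A] contributes a chosen point of [A]; boxes that miss [A] contribute the default [c0]. *)
Lemma dense_sequence A (c0 : d.-tuple R) : A c0 ->
  exists c : nat -> d.-tuple R, (forall j, A (c j)) /\
    forall t e, A t -> 0 < e -> exists j, tbox (c j) e t.
Proof.
move=> Ac0.
pose q2r (q : d.-tuple rat) : d.-tuple R := map_tuple (@ratr R) q.
pose sel (z : d.-tuple rat * nat) : d.-tuple R :=
  if pselect (exists c, (A `&` tbox (q2r z.1) z.2.+1%:R^-1) c) is left h
  then projT1 (cid h) else c0.
have Asel z : A (sel z).
  by rewrite /sel; case: pselect => // h; case: (cid h) => c /= [].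
exists (fun n => if unpickle n is Some z then sel z else c0); split.
  by move=> j; case: unpickle.
move=> t e At e0.
have e20 : 0 < e / 2 by rewrite divr_gt0.
have [m] := ltr_add_invr e20; rewrite add0r => me.
have qP (i : 'I_d) : exists q : rat, `|ratr q - tnth t i| < m.+1%:R^-1.
  have [|q] := @rat_in_itvoo R (tnth t i - m.+1%:R^-1) (tnth t i + m.+1%:R^-1).
    by rewrite ltrBlDr -addrA ltrDl addr_gt0.
  rewrite in_itv/= => /andP[q1 q2]; exists q.
  by rewrite ltr_norml ltrBrDr addrC q1 ltrBlDr addrC.
pose q : d.-tuple rat := [tuple projT1 (cid (qP i)) | i < d].
have qt : tbox (q2r q) m.+1%:R^-1 t.
  move=> i; rewrite tnth_map tnth_mktuple; exact: (projT2 (cid (qP i))).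
exists (pickle (q, m)); rewrite pickleK.
rewrite /sel; case: pselect => [h|]; last by case; exists t.
case: (cid h) => c /= [_ ct] i.
rewrite (splitr e) (le_lt_trans (ler_distD (tnth (q2r q) i) _ _))//.
rewrite ltrD//; first by rewrite distrC (lt_trans (ct i)).
by rewrite (lt_trans (qt i)).
Qed.

(** A closed set is the intersection over n of the union of the boxes of radius 1/(n+1) around a
    dense sequence of its points. *)
Lemma closed_tuple_measurable A : closed_tuple A -> measurable A.
Proof.
move=> clA; have [->|/set0P[c0 Ac0]] := eqVneq A set0; first exact: measurable0.
have [c [Ac dc]] := dense_sequence Ac0.
rewrite (_ : A = \bigcap_n \bigcup_j tbox (c j) n.+1%:R^-1).
  apply: bigcapT_measurable => n; apply: bigcupT_measurable => j.
  exact: measurable_tbox.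
apply/seteqP; split => t.
  by move=> At n _; have [//|j] := dc t n.+1%:R^-1 At; exists j.
move=> ht; apply: closed_tuple_tbox => // e e0.
have [n] := ltr_add_invr e0; rewrite add0r => ne.
have [j _ tj] := ht n I.
by exists (c j) => // i; rewrite (lt_trans (tj i)).
Qed.

(** Taking the first box that contains [t] cuts the space into countably many measurable cells. The
    default 0 keeps the rounding map total with values in the sequence, hence in [Theta], even at
    points far from [Theta]. *)
Definition net_index (c : nat -> d.-tuple R) (e : R) t : nat :=
  if pselect (exists j, `[< tbox (c j) e t >]) is left h then ex_minn h else 0%N.

Lemma net_index_tbox (c : nat -> d.-tuple R) e t : (exists j, tbox (c j) e t) ->
  tbox (c (net_index c e t)) e t.
Proof.
move=> [j cj]; rewrite /net_index; case: pselect => [h|]; last first.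
  by case; exists j; apply/asboolP.
by case: ex_minnP => n /asboolP.
Qed.

Lemma measurable_net_index c e j : measurable [set t | net_index c e t = j].
Proof.
pose B i := tbox (c i) e.
have mB i : measurable (B i) by exact: measurable_tbox.
have mF : measurable (B j `\` \bigcup_(i < j) B i).
  by apply: measurableD => //; exact: bigcup_measurable.
have iE t : (exists i, B i t) -> net_index c e t = j <->
    (B j `\` \bigcup_(i < j) B i) t.
  move=> [k Bk]; rewrite /net_index; case: pselect => [h|]; last first.
    by case; exists k; apply/asboolP.
  case: ex_minnP => n /asboolP Bn nmin; split => [<-|[Bj Bi]].
    split => // -[i /= ij Bi]; have := nmin i; rewrite leqNgt ij.
    by move=> /(_ (introT (asboolP _) Bi)).
  apply/eqP; rewrite eqn_leq (nmin _ (introT (asboolP _) Bj))/=.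
  by rewrite leqNgt; apply/negP => nj; apply: Bi; exists n.
have niE t : ~ (exists i, B i t) -> net_index c e t = 0%N.
  move=> h; rewrite /net_index; case: pselect => // h1; exfalso; move: h1 => [i /asboolP Bi].
  by apply: h; exists i.
have mU : measurable (\bigcup_i B i) by exact: bigcupT_measurable.
case: j => [|j] in mF iE *.
(* The fibre of 0 also collects the points that no box covers. *)
- rewrite (_ : [set _ | _] = (B 0%N `\` \bigcup_(i < 0) B i) `|` ~` (\bigcup_i B i)).
    by apply: measurableU => //; exact: measurableC.
  apply/seteqP; split => t /=.
    have [[i Bi]|nB] := pselect (exists i, B i t).
      by move=> /iE -/(_ (ex_intro _ i Bi)); left.
    by move=> _; right => -[i _ Bi]; apply: nB; exists i.
  move=> [h|h]; first by apply/iE => //; exists 0%N; case: h.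
  by apply: niE => -[i Bi]; apply: h; exists i.
- rewrite (_ : [set _ | _] = B j.+1 `\` \bigcup_(i < j.+1) B i)//.
  apply/seteqP; split => t /=.
    have [[i Bi]|nB] := pselect (exists i, B i t).
      by move=> /iE -/(_ (ex_intro _ i Bi)).
    by rewrite niE.
  by move=> h; apply/iE => //; exists j.+1; case: h.
Qed.

Definition net_proj (c : nat -> d.-tuple R) (e : R) t := c (net_index c e t).

Lemma measurable_net_proj c e : measurable_fun setT (net_proj c e).
Proof.
move=> _ Y mY; rewrite setTI.
rewrite (_ : _ @^-1` _ = \bigcup_(j in [set j | Y (c j)])
    [set t | net_index c e t = j]).
  by apply: bigcup_measurable => j _; exact: measurable_net_index.
apply/seteqP; split => t /=; first by exists (net_index c e t).
by move=> [j /= Yj] jE; rewrite /net_proj jE.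
Qed.

End grid.

(** * Integrability of exp(-|t|) *)

Section exponential_weight.
Context (R : realType).
Local Open Scope ereal_scope.

(** Up to the reflection x -> -x, the integrand on each half-line is the exponential density of rate
    1. *)
Lemma exponential_norm_lty : \int[@lebesgue_measure R]_x (expR (- `|x|))%:E < +oo.
Proof.
pose e (x : R) : \bar R := (expR (- `|x|))%:E.
have me : measurable_fun setT e.
  apply/measurable_EFinP; apply: measurableT_comp => //.
  by apply: measurableT_comp => //; exact: normr_measurable.
have e0 x : 0 <= e x by rewrite lee_fin expR_ge0.
have ep : \int[@lebesgue_measure R]_(x in `[0%R, +oo[) e x <= 1.
  rewrite -[leRHS](integral_exponential_pdf (@ltr01 R)).
  apply: (@le_trans _ _ (\int[@lebesgue_measure R]_(x in `[0%R, +oo[) (exponential_pdf 1 x)%:E)); last first.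
    apply: ge0_subset_integral => //.
      by apply/measurable_EFinP; exact: measurable_exponential_pdf.
    by move=> x _; rewrite lee_fin exponential_pdf_ge0.
  rewrite le_eqVlt; apply/orP; left; apply/eqP/eq_integral => x.
  rewrite inE/= in_itv/= andbT => x0.
  by rewrite exponential_pdfE// /e ger0_norm// mul1r mulN1r.
have en : \int[@lebesgue_measure R]_(x in `]-oo, 0%R]) e x <= 1.
  rewrite (le_trans _ ep)// ge0_integration_by_substitution0//.
  by under [leRHS]eq_integral do rewrite /e normrN.
rewrite -(setUv `]-oo, 0%R]%classic) ge0_integral_setU//=; last 3 first.
- exact: measurableC.
- by rewrite setUv.
- exact/disj_setPCl.
apply: (@le_lt_trans _ _ (1 + 1)); last by rewrite -EFinD ltry.
apply: leeD => //; apply: le_trans ep.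
apply: ge0_subset_integral => //; first exact: measurableC.
  exact: measurable_funTS.
by move=> x /=; rewrite !in_itv/= andbT => /negP; rewrite -ltNge => /ltW.
Qed.

Definition exp_weight n (t : n.-tuple R) : R := expR (- \sum_(i < n) `|tnth t i|).

Lemma measurable_exp_weight n : measurable_fun setT (@exp_weight n).
Proof.
apply: measurableT_comp => //; apply: measurableT_comp => //.
apply: measurable_sum => i; apply: measurableT_comp => //.
exact: measurable_tnth.
Qed.

(** The weight factorises over the coordinates, so Tonelli along the recursion defining
    [lebesgue_tuple] reduces to dimension one. It later dominates the integrand of [D_KW]. *)
Lemma integrable_exp_weight n :
  (lebesgue_tuple R n).-integrable setT (EFin \o @exp_weight n).
Proof.
apply/integrableP; split; first by apply/measurable_EFinP; exact: measurable_exp_weight.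
under eq_integral do rewrite /= ger0_norm ?expR_ge0//.
elim: n => [|n IH].
  rewrite /= integral_dirac ?diracT ?mul1e ?ltry//.
  by apply/measurable_EFinP; exact: measurable_exp_weight.
pose tc (z : measurableTypeR R * n.-tuple R) : n.+1.-tuple R := [tuple of z.1 :: z.2].
have mc : measurable_fun setT tc.
  exact: (@measurable_cons _ _ _ _ fst n snd).
rewrite [X in X < _](_ : _ =
  \int[pushforward (@lebesgue_measure R \x lebesgue_tuple R n) tc]_t
    (exp_weight t)%:E)//.
rewrite ge0_integral_pushforward//; last 2 first.
  by apply/measurable_EFinP; exact: measurable_exp_weight.
  by move=> t _; rewrite lee_fin expR_ge0.
rewrite preimage_setT.
pose w (z : measurableTypeR R * n.-tuple R) : \bar R := (expR (- `|z.1 : R|))%:E * (exp_weight z.2)%:E.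
rewrite [X in X < _](_ : _ = \int[@lebesgue_measure R \x lebesgue_tuple R n]_z w z); last first.
  apply: eq_integral => -[x t] _ /=; rewrite /w -EFinM /exp_weight big_ord_recl/= opprD expRD.
  by congr ((expR _ * expR (- _))%:E); apply: eq_bigr => i _; rewrite tnthS.
have mE : measurable_fun setT w.
  rewrite /w; under eq_fun do rewrite -EFinM.
  apply/measurable_EFinP; apply: measurable_funM.
    apply: measurableT_comp => //; apply: measurableT_comp => //.
    by apply: measurableT_comp => //; exact: normr_measurable.
  by apply: measurableT_comp; [exact: measurable_exp_weight|exact: measurable_snd].
rewrite fubini_tonelli1//; last first.
  by move=> z; rewrite mule_ge0// lee_fin expR_ge0.
rewrite /fubini_F/=.
rewrite [X in X < _](_ : _ = \int[@lebesgue_measure R]_x ((expR (- `|x|))%:E * \int[lebesgue_tuple R n]_t (exp_weight t)%:E)); last first.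
  apply: eq_integral => x _; rewrite /w/= ge0_integralZl//.
  - by apply/measurable_EFinP; exact: measurable_exp_weight.
  - by move=> t _; rewrite lee_fin expR_ge0.
have mn : measurable_fun setT (fun x : R => (expR (- `|x|))%:E).
  apply/measurable_EFinP; apply: measurableT_comp => //.
  by apply: measurableT_comp => //; exact: normr_measurable.
rewrite ge0_integralZr//; last first.
  by apply: integral_ge0 => t _; rewrite lee_fin expR_ge0.
rewrite lte_mul_pinfty//.
- by apply: integral_ge0 => x _; rewrite lee_fin expR_ge0.
- rewrite ge0_fin_numE ?exponential_norm_lty//.
  by apply: integral_ge0 => x _; rewrite lee_fin expR_ge0.
Qed.

End exponential_weight.

(** * Approximation of mixing distributions by discrete ones *)

Section discretisation.
Context (R : realType) (d : nat) (Theta : set (d.-tuple R)).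
Hypothesis clTheta : closed_tuple Theta.
Variables (c : nat -> d.-tuple R).
Hypothesis cTheta : forall j, Theta (c j).
Hypothesis cdense : forall t e, Theta t -> 0 < e -> exists j, tbox (c j) e t.

Let mTheta : measurable Theta := closed_tuple_measurable clTheta.

Definition net_mfun (e : R) : {mfun d.-tuple R >-> d.-tuple R} :=
  HB.pack (net_proj c e)
    (isMeasurableFun.Build _ _ _ _ (net_proj c e) (measurable_net_proj c e)).

Lemma net_mixing_subproof (G : mixing Theta) e :
  distribution (mixing_law G) (net_mfun e) Theta = 1%E.
Proof.
rewrite /distribution /pushforward/= (_ : _ @^-1` _ = setT) ?probability_setT//.
by apply/seteqP; split => // t _; exact: cTheta.
Qed.

(** The law of the rounded parameter: all its mass sits on the points [c j], so its mixture density
    is a series. *)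
Definition net_mixing (G : mixing Theta) (e : R) : mixing Theta :=
  exist _ (distribution (mixing_law G) (net_mfun e) : probability _ R)
    (net_mixing_subproof G e).

Lemma mixing_law_setC (G : mixing Theta) : mixing_law G (~` Theta) = 0%E.
Proof.
rewrite probability_setC//; have -> : mixing_law G Theta = 1%E by case: G.
by rewrite subee.
Qed.

Lemma ae_mixing_law (G : mixing Theta) : {ae mixing_law G, forall t, Theta t}.
Proof.
exists (~` Theta); split => //; [exact: measurableC|exact: mixing_law_setC].
Qed.

(** The c.d.f. at [t] is the measure of the section at [t] of the coordinatewise order, a measurable
    set of pairs. *)
Lemma measurable_mixing_cdf (G : mixing Theta) :
  measurable_fun setT (mixing_cdf G).
Proof.
apply: measurableT_comp => //.
pose B : set (d.-tuple R * d.-tuple R) := [set z | orthant z.1 z.2].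
have mB : measurable B.
  rewrite (_ : B = \bigcap_(i in [set: 'I_d])
      [set z : d.-tuple R * d.-tuple R | tnth z.2 i <= tnth z.1 i]).
    apply: fin_bigcap_measurable => // i _.
    rewrite -[X in measurable X]setTI.
    apply: (@measurable_fun_ler _ _ _ setT (fun z : d.-tuple R * d.-tuple R => tnth z.2 i)
      (fun z => tnth z.1 i) _ _ measurableT [set true]) => //.
      by apply: (measurableT_comp (measurable_tnth i)).
    by apply: (measurableT_comp (measurable_tnth i)).
  by apply/seteqP; split => z /= h i; [move=> _; exact: h|exact: (h i I)].
have := @measurable_fun_xsection _ _ _ _ _ (mixing_law G) B mB.
apply: eq_measurable_fun => t _ /=; congr (mixing_law G _).
by apply/seteqP; split => s; rewrite /xsection/= ?inE.
Qed.

(** Once the rounding error is smaller than every |s_i - t_i|, no coordinate can cross to the other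
    side of t_i. *)
Lemma near_orthant_net (t s : d.-tuple R) : Theta s ->
  (forall i, tnth s i != tnth t i) ->
  \forall n \near \oo, orthant t (net_proj c n.+1%:R^-1 s) <-> orthant t s.
Proof.
move=> Ts st.
suff : \forall n \near \oo, forall i : 'I_d,
    (tnth (net_proj c n.+1%:R^-1 s) i <= tnth t i) = (tnth s i <= tnth t i).
  apply: filterS => n h; split => h' i; first by rewrite -h.
  by rewrite h.
apply: filter_forall => i.
have e0 : 0 < `|tnth s i - tnth t i| by rewrite normr_gt0 subr_eq0.
near=> n.
have ne : n.+1%:R^-1 < `|tnth s i - tnth t i|.
  by near: n; exact: (near_infty_natSinv_lt (PosNum e0)).
have n0 : 0 < n.+1%:R^-1 :> R by [].
have /(_ i) := net_index_tbox (cdense Ts n0).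
rewrite -/(net_proj _ _ _); move: ne.
move: (n.+1%:R^-1) (tnth s i) (tnth t i) (tnth (net_proj _ _ _) i) => e a b p.
move=> eab pa; have {}pa := lt_trans pa eab.
apply/idP/idP => h; rewrite leNgt; apply/negP => h'; move: pa.
  rewrite (@gtr0_norm _ (a - b)) ?subr_gt0// ltr_norml => /andP[]; lra.
rewrite (@ler0_norm _ (a - b)) ?subr_le0// ltr_norml => /andP[]; lra.
Unshelve. all: by end_near. Qed.

Lemma cvg_net_orthant (G : mixing Theta) (t : d.-tuple R) :
  (forall i, mixing_law G [set s | tnth s i = tnth t i] = 0%E) ->
  mixing_cdf (net_mixing G n.+1%:R^-1) t @[n --> \oo] --> mixing_cdf G t.
Proof.
move=> Gt; rewrite /mixing_cdf /= /distribution /pushforward/=.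
pose O n := net_proj c n.+1%:R^-1 @^-1` orthant t.
have mO n : measurable (O n).
  rewrite -[X in measurable X]setTI; apply: measurable_net_proj => //.
  exact: measurable_orthant.
have mot := measurable_orthant t.
apply: fine_cvg; rewrite fineK ?fin_num_measure//.
have -> : mixing_law G (orthant t) = (\int[mixing_law G]_s (\1_(orthant t) s)%:E)%E.
  by rewrite integral_indic// setIT.
rewrite (_ : (fun n => _) = (fun n => \int[mixing_law G]_s (\1_(O n) s)%:E)%E); last first.
  by apply/funext => n; rewrite integral_indic// setIT.
have := @dominated_convergence _ _ _ (mixing_law G) setT measurableT
  (fun n s => (\1_(O n) s)%:E) (fun s => (\1_(orthant t) s)%:E) (cst 1%E).
move=> [].
- by move=> n; apply/measurable_EFinP; exact: measurable_indic.
- by apply/measurable_EFinP; exact: measurable_indic.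
- have h : {ae mixing_law G, forall s (i : 'I_d), tnth s i != tnth t i}.
    apply: filter_forall => i; exists [set s | tnth s i = tnth t i]; split => //.
      rewrite (_ : [set _ | _] = (fun s : d.-tuple R => tnth s i) @^-1` [set tnth t i])//.
      by rewrite -[X in measurable X]setTI; exact: measurable_tnth.
    by move=> s /= /negP; rewrite negbK => /eqP.
  apply: filterS2 h (ae_mixing_law G) => s st Ts _.
  apply: cvg_near_cst; have := near_orthant_net Ts st; apply: filterS => n h.
  congr EFin; rewrite !indicE; congr (nat_of_bool _)%:R.
  by apply/idP/idP; rewrite !inE => /h.
- exact: finite_measure_integrable_cst.
- by apply/aeW => s n _; rewrite /= lee_fin ger0_norm// indicE; case: (_ \in _).
- by move=> _ _.
Qed.

(** The hyperplane through [t] is charged only if t_i is an atom of the i-th marginal of [G]. There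
    are countably many atoms, so the exceptional [t] have a coordinate in a Lebesgue-null set. *)
Lemma ae_mixing_hyperplane (G : mixing Theta) (i : 'I_d) :
  {ae lebesgue_tuple R d, forall t,
    mixing_law G [set s | tnth s i = tnth t i] = 0%E}.
Proof.
pose X : {mfun d.-tuple R >-> R} := HB.pack (fun s : d.-tuple R => tnth s i)
  (isMeasurableFun.Build _ _ _ _ (fun s : d.-tuple R => tnth s i) (measurable_tnth i)).
pose C := [set r | 0 < pmf (X : {RV mixing_law G >-> R}) r].
have cC : countable C by exact: pmf_gt0_countable.
have mC : measurable C by exact: countable_measurable.
pose A (j : 'I_d) := if j == i then C else setT.
have mA j : measurable (A j) by rewrite /A; case: ifP.
exists [set t : d.-tuple R | forall j, A j (tnth t j)]; split.
- exact: (measurable_tuple_all mA).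
(* The remaining factors are measures of the whole line; the convention 0 * oo = 0 makes the product
   vanish. *)
- rewrite lebesgue_tuple_box// (bigD1 i)//= /A eqxx.
  by rewrite countable_lebesgue_measure0// mul0e.
- move=> t /= ht j; rewrite /A; case: eqP => // ->.
  rewrite /C/= /pmf lt_neqAle fine_ge0// andbT; apply/eqP => h; apply: ht.
  have mS : measurable [set s : d.-tuple R | tnth s i = tnth t i].
    rewrite (_ : [set _ | _] = (fun s : d.-tuple R => tnth s i) @^-1` [set tnth t i])//.
    by rewrite -[X in measurable X]setTI; exact: measurable_tnth.
  by rewrite -[LHS]fineK ?fin_num_measure//; congr EFin; exact/esym.
Qed.

(** The c.d.f.s converge at every [t] whose coordinate hyperplanes are not charged by [G], that is,
    almost everywhere. They differ by at most 1, so [exp_weight] dominates. *)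
Lemma cvg_D_KW_net (G : mixing Theta) :
  D_KW (net_mixing G n.+1%:R^-1) G @[n --> \oo] --> (0 : R).
Proof.
rewrite /D_KW /Rintegral; apply: fine_cvg.
rewrite -[X in _ --> X](@integral0 _ _ _ (lebesgue_tuple R d) Theta).
pose w (t : d.-tuple R) : \bar R := (exp_weight t)%:E.
have := @dominated_convergence _ _ _ (lebesgue_tuple R d) Theta mTheta
  (fun n t => (`|mixing_cdf (net_mixing G n.+1%:R^-1) t - mixing_cdf G t| *
    expR (- \sum_(i < d) `|tnth t i|))%:E) (cst 0%E) w.
move=> [].
- move=> n; apply/measurable_EFinP/measurable_funTS; apply: measurable_funM.
    apply: measurableT_comp => //.
    by apply: measurable_funB; exact: measurable_mixing_cdf.
  exact: measurable_exp_weight.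
- exact: measurable_cst.
- have h : {ae lebesgue_tuple R d, forall t (i : 'I_d),
      mixing_law G [set s | tnth s i = tnth t i] = 0%E}.
    apply: (filter_forall (f := fun i t => mixing_law G [set s : d.-tuple R | tnth s i = tnth t i] = 0%E)) => i. exact: ae_mixing_hyperplane.
  apply: filterS h => t ht _; apply/fine_cvgP; split; first exact: nearW.
  rewrite /= -[X in _ --> X](mul0r (exp_weight t)); apply: cvgM; last exact: cvg_cst.
  rewrite -[X in _ --> X](@normr0 _ R) -(subrr (mixing_cdf G t)).
  by apply: cvg_norm; apply: cvgB; [exact: cvg_net_orthant|exact: cvg_cst].
- apply: integrableS (integrable_exp_weight R d) => //.
- apply/aeW => t n _; rewrite /w lee_fin normrM normr_id ger0_norm ?expR_ge0//.
  rewrite ler_piMl ?expR_ge0//.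
  have cdf01 (H : mixing Theta) : 0 <= mixing_cdf H t <= 1.
    rewrite fine_ge0//= -lee_fin fineK ?fin_num_measure ?probability_le1//;
      exact: measurable_orthant.
  have /andP[a0 a1] := cdf01 (net_mixing G n.+1%:R^-1).
  have /andP[b0 b1] := cdf01 G.
  by rewrite ler_norml; apply/andP; split; lra.
- by move=> _ _.
Qed.
End discretisation.

(** * Mixture densities *)

Section mixture_density.
Context (R : realType) (k d : nat) (mu : {measure set (k.-tuple R) -> \bar R}).
Context (Theta : set (d.-tuple R)) (f : k.-tuple R -> d.-tuple R -> R).
Hypothesis hf : density_family Theta mu f.
Hypothesis clTheta : closed_tuple Theta.
Hypothesis ctsf : continuous_density (@D_KW R d Theta) (mix_density f).
Local Open Scope ereal_scope.

Let mTheta : measurable Theta := closed_tuple_measurable clTheta.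
Let mXTheta : measurable ([set: k.-tuple R] `*` Theta).
Proof. exact: measurableX. Qed.

Lemma measurable_density_x t : Theta t -> measurable_fun setT (f ^~ t).
Proof.
move=> Tt; case: hf => mf _ _.
apply: (@measurable_comp _ _ _ _ _ _ _ (fun z => f z.1 z.2) setT (fun x => (x, t)) mXTheta _ mf).
  by move=> _ [x _ <-].
exact: measurable_pair2.
Qed.

Lemma measurable_density_t x : measurable_fun Theta (f x).
Proof.
case: hf => mf _ _.
apply: (@measurable_comp _ _ _ _ _ _ _ (fun z => f z.1 z.2) Theta (fun t => (x, t)) mXTheta _ mf).
  by move=> _ [t Tt <-].
apply: measurable_funTS; exact: measurable_pair1.
Qed.

Lemma mix_density_ge0 (G : mixing Theta) x : 0 <= mix_density f x G.
Proof.
by case: hf => _ f0 _; apply: integral_ge0 => t Tt; rewrite lee_fin; exact: f0.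
Qed.

Lemma mix_density_net c (cT : forall j, Theta (c j)) (G : mixing Theta) e x :
  mix_density f x (net_mixing cT G e) =
  \sum_(j <oo) (f x (c j))%:E * mixing_law G [set t | net_index c e t = j].
Proof.
case: hf => _ f0 _.
rewrite /mix_density /= /distribution ge0_integral_pushforward//=; last 3 first.
- exact: measurable_net_proj.
- by apply/measurable_EFinP; exact: measurable_density_t.
- by move=> t /[!inE] Tt; rewrite lee_fin f0.
pose E j := [set t | net_index c e t = j].
have mE j : measurable (E j) by exact: measurable_net_index.
have -> : net_proj c e @^-1` Theta = \bigcup_j E j.
  apply/seteqP; split => t //=; first by exists (net_index c e t).
  by move=> _; exact: cT.
have UE : \bigcup_j E j = setT.
  by apply/seteqP; split => // t _; exists (net_index c e t).
rewrite ge0_integral_bigcup//.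
- apply: eq_eseriesr => j _.
  rewrite (eq_integral (cst (f x (c j))%:E)) ?integral_cst//.
  by move=> t /[!inE]; rewrite /E/= /net_proj => ->.
- rewrite UE; apply/measurable_EFinP.
  apply: (@measurable_comp _ _ _ _ _ _ Theta) => //.
  + by move=> _ [t _ <-]; exact: cT.
  + exact: measurable_density_t.
  + exact: measurable_net_proj.
- by move=> t _; rewrite lee_fin f0//; exact: cT.
- apply/trivIsetP => i j _ _ /eqP ij; apply/seteqP; split => // t [/= Ei Ej].
  by apply: ij; rewrite -Ei.
Qed.

Lemma measurable_mix_density_net c (cT : forall j, Theta (c j)) (G : mixing Theta) e :
  measurable_fun setT (fun x => mix_density f x (net_mixing cT G e)).
Proof.
case: hf => _ f0 _.
under eq_fun do rewrite mix_density_net.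
apply: ge0_emeasurable_sum => [j x _ _|j _].
  by rewrite mule_ge0// lee_fin f0.
apply: emeasurable_funM => //; apply/measurable_EFinP; exact: measurable_density_x.
Qed.

(** Integral and countable series of nonnegative terms commute for every measure [mu]; the weights
    are the masses of the cells and sum to 1. *)
Lemma integral_mix_density_net c (cT : forall j, Theta (c j)) (G : mixing Theta) e :
  \int[mu]_x mix_density f x (net_mixing cT G e) = 1.
Proof.
case: hf => _ f0 f1.
under eq_integral do rewrite mix_density_net.
have mj j : measurable_fun setT (fun x => (f x (c j))%:E).
  by apply/measurable_EFinP; exact: measurable_density_x.
rewrite integral_nneseries//; last 2 first.
- by move=> j; apply: emeasurable_funM.
- by move=> j x _; rewrite mule_ge0// lee_fin f0.
rewrite (eq_eseriesr (g := fun j => mixing_law G [set t | net_index c e t = j])); last first.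
  move=> j _; rewrite ge0_integralZr//; first by rewrite f1// mul1e.
  by move=> x _; rewrite lee_fin f0.
rewrite -(@probability_setT _ _ _ (mixing_law G)).
have -> : [set: d.-tuple R] = \bigcup_j [set t | net_index c e t = j].
  by apply/seteqP; split => // t _; exists (net_index c e t).
rewrite measure_bigcup//; first by apply: eq_eseriesl => j; rewrite in_setT.
- by move=> j _; exact: measurable_net_index.
- apply/trivIsetP => i j _ _ /eqP ij; apply/seteqP; split => // t [/= Ei Ej].
  by apply: ij; rewrite -Ei.
Qed.

Lemma mix_density_net_approx (G : mixing Theta) :
  exists c (cT : forall j, Theta (c j)), forall x,
    mix_density f x (net_mixing cT G n.+1%:R^-1) @[n --> \oo] --> mix_density f x G.
Proof.
have [T0|/set0P[c0 Tc0]] := eqVneq Theta set0.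
  have : mixing_law G Theta = 0 by rewrite [X in mixing_law G X]T0 measure0.
  have -> : mixing_law G Theta = 1 by case: (G).
  by move=> /eqP; rewrite onee_eq0.
have [c [cT cdense]] := dense_sequence Tc0.
exists c, cT => x.
apply: (@cvg_comp _ _ _ (fun n => net_mixing cT G n.+1%:R^-1) (mix_density f x)
  _ (dist_nbhs (@D_KW R d Theta) G)); last exact: ctsf.
move=> A [e /= e0 eA].
have := cvg_D_KW_net clTheta cT cdense G.
move=> /cvgrPdist_lt/(_ e e0); apply: filterS => n; rewrite sub0r normrN => h.
by apply: eA => /=; rewrite (le_lt_trans (ler_norm _)).
Qed.

Lemma measurable_mix_density (G : mixing Theta) :
  measurable_fun setT (mix_density f ^~ G).
Proof.
have [c [cT h]] := mix_density_net_approx G.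
apply: (emeasurable_fun_cvg (fun n x => mix_density f x (net_mixing cT G n.+1%:R^-1))).
  by move=> n; exact: measurable_mix_density_net.
by move=> x _; exact: h.
Qed.

(* [mu] need not be sigma-finite, so Tonelli is not available; Fatou along the
   discrete mixing distributions replaces it. *)
Lemma integral_mix_density_le1 (G : mixing Theta) :
  \int[mu]_x mix_density f x G <= 1.
Proof.
have [c [cT h]] := mix_density_net_approx G.
pose g n x := mix_density f x (net_mixing cT G n.+1%:R^-1).
rewrite (eq_integral (fun x => limn_einf (g ^~ x))); last first.
  by move=> x _; rewrite (cvg_limn_einf_sup (h x)).1.
apply: le_trans (fatou _ _ _ _) _ => //.
- by move=> n; exact: measurable_mix_density_net.
- by move=> n x _; exact: mix_density_ge0.
- rewrite (_ : (fun n => _) = cst 1); last first.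
    by apply/funext => n; exact: integral_mix_density_net.
  by rewrite (cvg_limn_einf_sup (cvg_cst _)).1.
Qed.

End mixture_density.

(** * Random walks with negative drift *)

Lemma ge0_integral_mrestr d (T : measurableType d) (R : realType)
    (m : {measure set T -> \bar R}) (D : set T) (mD : measurable D)
    (f : T -> \bar R) : measurable_fun setT f -> (forall x, 0 <= f x)%E ->
  (\int[mrestr m mD]_x f x = \int[m]_(x in D) f x)%E.
Proof.
move=> mf f0; rewrite -(setUv D) ge0_integral_setU//=; last 3 first.
- exact: measurableC.
- by rewrite setUv.
- exact/disj_setPCl.
rewrite [X in (_ + X)%E](_ : _ = 0%E) ?adde0.
  apply: eq_measure_integral => A mA AD; rewrite /mrestr; congr (m _).
  exact/setIidPl.
apply: null_set_integral => //; first exact: measurableC.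
- exact: measurable_funTS.
- by rewrite /= /mrestr setICl measure0.
Qed.

(** * Real sequences with the cylinder sigma-algebra *)

Section sequence_space.
Context (R : realType).

(** Rectangles on finitely many initial coordinates: a pi-system, so finite measures that agree on
    it coincide. *)
Definition cylinder : set (set (nat -> R)) :=
  [set A | exists n (B : nat -> set R), (forall i, measurable (B i)) /\
    A = [set s | forall i, (i < n)%N -> B i (s i)]].

Definition seqspace := g_sigma_algebraType cylinder.

Definition shift (s : seqspace) : seqspace := fun i => s i.+1.

Lemma setI_closed_cylinder : setI_closed cylinder.
Proof.
move=> _ _ [n [B [mB ->]]] [m [C [mC ->]]].
exists (maxn n m), (fun i => (if (i < n)%N then B i else setT) `&`
  (if (i < m)%N then C i else setT)); split.
  by move=> i; apply: measurableI; case: ifP.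
apply/seteqP; split => s /=.
  by move=> [Bs Cs] i _; split; case: ifP => //; [exact: Bs|exact: Cs].
move=> h; split => i ij.
  by have := h i; rewrite leq_max ij /= => /(_ isT)[].
by have := h i; rewrite leq_max ij orbT => /(_ isT)[].
Qed.

Lemma measurable_cylinder (A : set seqspace) : cylinder A -> measurable A.
Proof. exact: sub_sigma_algebra. Qed.

Lemma measurable_coord i : measurable_fun [set: seqspace] (fun s : seqspace => s i : R).
Proof.
move=> _ B mB; rewrite setTI; apply: measurable_cylinder.
exists i.+1, (fun j => if j == i then B else setT); split.
  by move=> j; case: ifP.
apply/seteqP; split => s /=; first by move=> Bs j _; case: eqP => // ->.
by move=> /(_ i (ltnSn i)); rewrite eqxx.
Qed.

Lemma measurable_shift : measurable_fun [set: seqspace] shift.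
Proof.
apply: (@measurability _ _ _ _ setT shift cylinder) => //.
move=> _ [_ [n [B [mB ->]] <-]]; rewrite setTI; apply: measurable_cylinder.
exists n.+1, (fun j => if j is j'.+1 then B j' else setT); split.
  by case.
apply/seteqP; split => s /=; first by move=> Bs [|j]// /Bs.
by move=> Bs i i_n; exact: (Bs i.+1).
Qed.

Lemma cylinder_measure_unique (m1 m2 : {measure set seqspace -> \bar R}) :
  (m1 setT < +oo)%E -> (forall A, cylinder A -> m1 A = m2 A) ->
  forall A, measurable A -> m1 A = m2 A.
Proof.
move=> m1oo m12 A mA; apply: (@measure_unique _ _ seqspace cylinder (fun=> setT)) => //.
- exact: setI_closed_cylinder.
- by move=> _; exists 0%N, (fun=> setT); split => //; apply/seteqP; split.
- by rewrite bigcup_const//; exists 0%N.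
Qed.

End sequence_space.

(** * Running maxima of a walk with independent, stationary steps *)

Section negative_drift.
Context (R : realType) (L : probability (seqspace R) R).
Hypothesis Lind : forall (B : set R) (A : set (seqspace R)),
  measurable B -> measurable A ->
  L ([set s : seqspace R | B (s 0%N)] `&` @shift R @^-1` A) =
  (L [set s : seqspace R | B (s 0%N)] * L A)%E.
Hypothesis intL : L.-integrable setT (fun s : seqspace R => (s 0%N)%:E).

Let mcoord := measurable_coord.
Let mshift := @measurable_shift R.

(** The case of an unconstrained first coordinate in [Lind], which thus encodes stationarity
    together with independence. *)
Lemma shift_invariant (A : set (seqspace R)) : measurable A ->
  L (@shift R @^-1` A) = L A.
Proof.
move=> mA; have := Lind measurableT mA.
rewrite (_ : [set s | _] = setT) ?setTI//.
by rewrite probability_setT mul1e.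
Qed.

(** The maximum of 0 and the first n partial sums. Peeling off the first step instead of the last
    brings in the shift. *)
Fixpoint running_max (n : nat) (s : seqspace R) : R :=
  if n is n'.+1 then Num.max 0 (s 0%N + running_max n' (shift s)) else 0.

Lemma running_max_ge0 n s : 0 <= running_max n s.
Proof. by case: n => //= n; rewrite le_max lexx. Qed.

Lemma measurable_running_max n : measurable_fun setT (running_max n).
Proof.
elim: n => [|n IH] /=; first exact: measurable_cst.
apply: (@measurable_maxr _ _ _ _ (cst 0)) => //.
by apply: measurable_funD; [exact: mcoord|exact: measurableT_comp].
Qed.

Lemma running_maxS n s : running_max n s <= running_max n.+1 s.
Proof.
elim: n s => [|n IH] s; first exact: running_max_ge0.
rewrite -/(running_max n.+1 (shift s)) /=.
rewrite ge_max !le_max lexx/=; apply/orP; right.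
by rewrite lerD2l; have := IH (shift s); rewrite /= .
Qed.

Lemma running_max_nd s : {homo running_max ^~ s : m n / (m <= n)%N >-> m <= n}.
Proof. by apply: homo_leq => // [? ? ?|n]; [exact: le_trans|exact: running_maxS]. Qed.

Lemma partial_sum_le_running_max n (s : seqspace R) :
  \sum_(i < n) s (i : nat) <= running_max n s.
Proof.
elim: n s => [|n IH] s; first by rewrite big_ord0.
rewrite big_ord_recl/= le_max; apply/orP; right; rewrite lerD2l.
exact: IH.
Qed.

Lemma integrable_running_max n : L.-integrable setT (EFin \o running_max n).
Proof.
have mE m : measurable_fun setT (EFin \o running_max m).
  by apply/measurable_EFinP; exact: measurable_running_max.
elim: n => [|n IH]; first exact: integrable0.
have IHs : L.-integrable setT ((EFin \o running_max n) \o @shift R).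
  apply/integrableP; split; first exact: measurableT_comp.
  have [_] := integrableP _ _ _ IH; apply: le_lt_trans.
  rewrite le_eqVlt; apply/orP; left; apply/eqP.
  have -> : (\int[L]_x `|(EFin \o running_max n) x| =
      \int[pushforward L (@shift R)]_x `|(EFin \o running_max n) x|)%E.
    by apply: eq_measure_integral => A mA _; rewrite -[LHS]shift_invariant.
  rewrite ge0_integral_pushforward//=; apply/measurable_EFinP.
  by apply: measurableT_comp => //; exact: measurable_running_max.
have := integrableD measurableT (integrable_abse intL) IHs.
apply: le_integrable => // s _ /=.
rewrite lee_fin ger0_norm ?le_max ?lexx// ger0_norm ?addr_ge0 ?running_max_ge0//.
rewrite ge_max addr_ge0 ?running_max_ge0//=.
by rewrite lerD2r ler_norm.
Qed.

Definition unbounded_max : set (seqspace R) :=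
  \bigcap_m \bigcup_n [set s | m%:R < running_max n s].

Lemma measurable_unbounded_max : measurable unbounded_max.
Proof.
apply: bigcapT_measurable => m; apply: bigcupT_measurable => n.
rewrite -[X in measurable X]setTI.
by apply: (@measurable_fun_ltr _ _ _ setT (cst m%:R) (running_max n) _ _ measurableT [set true])
  => //; exact: measurable_running_max.
Qed.

Lemma unbounded_maxP s : unbounded_max s <-> forall r, exists n, r < running_max n s.
Proof.
split=> [h r|h m _]; last by have [n] := h m%:R; exists n.
have [n _ /= hn] := h (Num.bound `|r|) I.
exists n; apply: le_lt_trans hn; exact/ltW/(le_lt_trans (ler_norm r))/archi_boundP.
Qed.

(** Passing from the maxima of [shift s] to those of [s] adds the fixed real [s 0], which does not
    affect unboundedness. *)
Lemma shift_unbounded_max : @shift R @^-1` unbounded_max = unbounded_max.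
Proof.
apply/seteqP; split => s /unbounded_maxP h; apply/unbounded_maxP => r.
  have [n hn] := h (r - s 0%N).
  by exists n.+1; rewrite /= lt_max -ltrBlDl hn orbT.
have [[|n]] := h (Num.max 0 (r + s 0%N)); rewrite /= ?gt_max ?ltxx//.
rewrite !lt_max ltxx/= => /andP[b0 /orP[h'|h']]; exists n; lra.
Qed.

(** By [Lind], the law of the first coordinate restricted to the event is its full law scaled by
    [L A]. Positive and negative parts are integrated separately against these two equal
    measures. *)
Lemma integral_shift_indep (A : set (seqspace R)) : measurable A ->
  (\int[L]_(s in @shift R @^-1` A) (s 0%N)%:E = L A * \int[L]_s (s 0%N)%:E)%E.
Proof.
move=> mA.
have mSA : measurable (@shift R @^-1` A).
  by rewrite -[X in measurable X]setTI; exact: mshift.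
have ge0 (g : R -> R) : measurable_fun setT g -> (forall r, 0 <= g r) ->
    (\int[L]_(s in @shift R @^-1` A) (g (s 0%N))%:E =
      L A * \int[L]_s (g (s 0%N))%:E)%E.
  move=> mg g0.
  have mEg : measurable_fun setT (EFin \o g) by exact/measurable_EFinP.
  pose c : {nonneg R} := NngNum (fine_ge0 (measure_ge0 L A)).
  have cE : (c%:num)%:E = L A by rewrite /c /= fineK ?fin_num_measure.
  pose p0 : {mfun seqspace R >-> R} := HB.pack (fun s : seqspace R => s 0%N : R)
    (isMeasurableFun.Build _ _ _ _ (fun s : seqspace R => s 0%N : R) (mcoord 0%N)).
  pose m1 := pushforward (mrestr L mSA) p0.
  pose m2 := mscale c (distribution L p0).
  have m12 B : measurable B -> m1 B = m2 B.
    move=> mB.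
    transitivity ((c%:num)%:E * distribution L p0 B)%E; last by [].
    rewrite cE /m1 /distribution /pushforward /mrestr.
    by rewrite muleC; exact: Lind.
  transitivity (\int[m1]_r (g r)%:E)%E.
    rewrite ge0_integral_pushforward//=; [|exact: (mcoord 0%N)|by move=> r _; rewrite lee_fin].
    rewrite [RHS](ge0_integral_mrestr L mSA (f := fun s => (g (s 0%N))%:E))//.
      exact: (measurableT_comp mEg (mcoord 0%N)).
    by move=> s; rewrite lee_fin.
  transitivity (\int[m2]_r (g r)%:E)%E.
    by apply: eq_measure_integral => B mB _; exact: m12.
  transitivity ((c%:num)%:E * \int[distribution L p0]_r (g r)%:E)%E.
    by apply: ge0_integral_mscale => // r _; rewrite lee_fin.
  by rewrite cE ge0_integral_distribution// => r; rewrite lee_fin.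
have pE s : ((fun s : seqspace R => (s 0%N)%:E)^\+%E s = (Num.max (s 0%N) 0)%:E)%E.
  by rewrite funeposE -EFin_max.
have nE s : ((fun s : seqspace R => (s 0%N)%:E)^\-%E s = (Num.max (- s 0%N) 0)%:E)%E.
  by rewrite funenegE -EFinN -EFin_max.
have Ip := integral_funepos_lt_pinfty measurableT intL.
have In := integral_funeneg_lt_pinfty measurableT intL.
rewrite integralE [in RHS]integralE muleBr ?fin_num_measure//; last first.
  apply: fin_num_adde_defr; rewrite ge0_fin_numE//.
  exact: integral_ge0.
congr (_ - _)%E.
- under eq_integral do rewrite pE.
  under [in RHS]eq_integral do rewrite pE.
  apply: (ge0 (fun r => Num.max r 0)); last by move=> r; rewrite le_max lexx orbT.
  by apply: (@measurable_maxr _ _ _ setT id (cst 0)) => //; exact: measurable_id.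
- under eq_integral do rewrite nE.
  under [in RHS]eq_integral do rewrite nE.
  apply: (ge0 (fun r => Num.max (- r) 0)); last by move=> r; rewrite le_max lexx orbT.
  by apply: (@measurable_maxr _ _ _ setT (fun r : R => - r) (cst 0)) => //; exact: oppr_measurable.
Qed.

(* On the shift-invariant event where the running maximum is unbounded, the
   increments M_(n+1) - M_n o shift have nonnegative integrals and converge to
   the first coordinate, which is independent of that event. *)
Lemma unbounded_max_null : (\int[L]_s (s 0%N)%:E < 0)%E -> L unbounded_max = 0%E.
Proof.
move=> neg; apply/eqP; rewrite -measure_le0; apply: contraTT neg.
rewrite -ltNge -leNgt => LA0.
have mA := measurable_unbounded_max; set A := unbounded_max in mA LA0 *.
suff : (0 <= \int[L]_(s in A) (s 0%N)%:E)%E.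
  rewrite -[X in integral _ X]shift_unbounded_max integral_shift_indep//.
  by rewrite pmule_rge0.
have intS (f : seqspace R -> \bar R) : L.-integrable setT f -> L.-integrable A f.
  exact: integrableS.
pose D n (s : seqspace R) := running_max n.+1 s - running_max n (shift s).
have mD n : measurable_fun setT (D n).
  apply: measurable_funB; first exact: measurable_running_max.
  by apply: measurableT_comp => //; exact: measurable_running_max.
(* The increment is the larger of [s 0] and [- running_max n (shift s)]; when the latter is the
   larger, it lies between [s 0] and 0. *)
have Dle n s : `|D n s| <= `|s 0%N|.
  have := running_max_ge0 n (shift s); rewrite /D/=.
  move: (running_max _ _) (s 0%N) => M z M0.
  case: (leP 0 (z + M)) => [zM|zM]; first by rewrite addrK.
  rewrite sub0r normrN (ger0_norm M0) ler0_norm; lra.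
have cvgD : (\int[L]_(s in A) (D n s)%:E)%E @[n --> \oo] --> (\int[L]_(s in A) (s 0%N)%:E)%E.
  have := @dominated_convergence _ _ _ L A mA
    (fun n s => (D n s)%:E) (fun s => (s 0%N)%:E) (fun s => `|(s 0%N)%:E|%E).
  move=> [].
  - by move=> n; apply/measurable_EFinP/measurable_funTS.
  - by apply/measurable_EFinP/measurable_funTS; exact: mcoord.
  - apply/aeW => s As.
    have : A (shift s) by rewrite -[A (shift s)]/((@shift R @^-1` A) s) shift_unbounded_max.
    move=> /unbounded_maxP/(_ (- s 0%N))[N hN].
    apply: cvg_near_cst; exists N => // n /= Nn; congr EFin.
    have := running_max_nd (shift s) Nn; rewrite /D /=.
    move: (running_max n _) hN => M hN NM.
    by rewrite max_r ?addrK//; lra.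
  - exact/intS/integrable_abse.
  - by apply/aeW => s n _; rewrite /= lee_fin.
  - by move=> _ _.
rewrite -(cvg_lim _ cvgD)//; apply: lime_ge; first by apply/cvg_ex; eexists; exact: cvgD.
apply: nearW => n.
have iM m : L.-integrable A (EFin \o running_max m) by exact/intS/integrable_running_max.
have shiftM : (\int[L]_(s in A) (running_max n (shift s))%:E = \int[L]_(s in A) (running_max n s)%:E)%E.
  have mM : measurable_fun setT (EFin \o running_max n).
    by apply/measurable_EFinP; exact: measurable_running_max.
  transitivity (\int[pushforward L (@shift R)]_(s in A) (running_max n s)%:E)%E.
    rewrite ge0_integral_pushforward//=.
    - by rewrite shift_unbounded_max.
    - exact: measurable_funTS.
    - by move=> s _; rewrite lee_fin running_max_ge0.
  by apply: eq_measure_integral => B mB _; rewrite -[RHS]shift_invariant.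
under eq_integral do rewrite EFinB.
rewrite integralB_EFin//; last first.
  apply/integrableP; split.
    apply/measurable_EFinP/measurable_funTS; apply: measurableT_comp => //.
    exact: measurable_running_max.
  have := iM n => /integrableP[_]; apply: le_lt_trans.
  rewrite (eq_integral (fun s => (running_max n (shift s))%:E)); last first.
    by move=> s _ /=; rewrite ger0_norm ?running_max_ge0.
  rewrite shiftM; apply: ge0_le_integral => //.
  - by move=> s _; rewrite lee_fin running_max_ge0.
  - exact: (measurable_int _ (iM n)).
  - by apply: measurableT_comp => //; exact: (measurable_int _ (iM n)).
  - by move=> s _; rewrite lee_fin ler_norm.
rewrite shiftM sube_ge0; last by apply/orP; left; exact: (integrable_fin_num mA (iM n)).
by apply: le_integral (iM n) (iM n.+1) _ => // s _; rewrite lee_fin running_maxS.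
Qed.

Lemma ae_bounded_partial_sums : (\int[L]_s (s 0%N)%:E < 0)%E ->
  {ae L, forall s : seqspace R, exists C, forall n, \sum_(i < n) s (i : nat) <= C}.
Proof.
move=> neg; exists unbounded_max; split => //.
- exact: measurable_unbounded_max.
- exact: unbounded_max_null.
- move=> s /= h; apply/unbounded_maxP => r; apply: contrapT => h'; apply: h.
  exists r => n; apply: le_trans (partial_sum_le_running_max _ _) _.
  by rewrite leNgt; apply/negP => h; apply: h'; exists n.
Qed.

End negative_drift.

(** * Transfer to functions of an i.i.d. sample *)

Section iid_drift.
Context d d' (Omega : measurableType d) (T : measurableType d') (R : realType).
Context (P : probability Omega R) (X : nat -> {RV P >-> T}).
Hypothesis Xsame : forall i A, measurable A -> P (X i @^-1` A) = P (X 0%N @^-1` A).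
Hypothesis Xind : forall n (A : nat -> set T), (forall i, measurable (A i)) ->
  P (\bigcap_(i in `I_n) (X i @^-1` A i)) = (\prod_(i < n) P (X i @^-1` A i))%E.

Section path.
Variables (phi : T -> R) (mphi : measurable_fun setT phi).

Definition path_of (w : Omega) : seqspace R := fun i => phi (X i w).

Lemma measurable_path_of : measurable_fun setT path_of.
Proof.
apply: (@measurability _ _ _ _ setT path_of (@cylinder R)) => //.
move=> _ [_ [n [B [mB ->]]] <-]; rewrite setTI.
rewrite (_ : _ @^-1` _ = \bigcap_(i in `I_n) ((phi \o X i) @^-1` B i)).
  apply: fin_bigcap_measurable; first exact: finite_II.
  move=> i _; rewrite -[X in measurable X]setTI.
  by apply: measurableT_comp => //.
by apply/seteqP; split => w /= h i; exact: h.
Qed.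

Definition path_mfun : {mfun Omega >-> seqspace R} :=
  HB.pack path_of (isMeasurableFun.Build _ _ _ _ path_of measurable_path_of).

Definition path_law : probability (seqspace R) R := distribution P path_mfun.

Lemma path_law_cylinder n (B : nat -> set R) : (forall i, measurable (B i)) ->
  path_law [set s | forall i, (i < n)%N -> B i (s i)] =
  (\prod_(i < n) P (X 0%N @^-1` (phi @^-1` B i)))%E.
Proof.
move=> mB.
have mC i : measurable (phi @^-1` B i).
  by rewrite -[X in measurable X]setTI; exact: mphi.
transitivity (\prod_(i < n) P (X i @^-1` (phi @^-1` B i)))%E.
  rewrite -(Xind n mC) /path_law /distribution /pushforward/=.
  suff -> : \bigcap_(i < n) X i @^-1` (phi @^-1` B i) =
    path_of @^-1` [set s | forall i, (i < n)%N -> B i (s i)] by [].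
  by apply/seteqP; split => w /= h i; exact: h.
by apply: eq_bigr => i _; exact: Xsame.
Qed.

(** Both sides are finite measures in [A], so cylinders suffice; there, a condition on the first
    coordinate and a cylinder for the shift form a cylinder one coordinate longer. *)
Lemma path_law_shift_indep (B : set R) (A : set (seqspace R)) :
  measurable B -> measurable A ->
  path_law ([set s : seqspace R | B (s 0%N)] `&` @shift R @^-1` A) =
  (path_law [set s : seqspace R | B (s 0%N)] * path_law A)%E.
Proof.
move=> mB mA.
have mB0 : measurable [set s : seqspace R | B (s 0%N)].
  rewrite (_ : [set s | _] = (fun s : seqspace R => s 0%N : R) @^-1` B)//.
  by rewrite -[X in measurable X]setTI; exact: measurable_coord.
pose c : {nonneg R} := NngNum (fine_ge0 (measure_ge0 path_law [set s : seqspace R | B (s 0%N)])).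
have cE : (c%:num)%:E = path_law [set s : seqspace R | B (s 0%N)].
  by rewrite /c /= fineK ?fin_num_measure.
pose m1 := measure_function_pushforward__canonical__measure_function_Measure
  (mrestr path_law mB0) (@measurable_shift R).
rewrite -cE setIC; apply: (@cylinder_measure_unique R m1 (mscale c path_law)) => //.
  rewrite /m1/= /pushforward /mrestr preimage_setT setTI.
  by rewrite -ge0_fin_numE ?fin_num_measure.
move=> _ [n [C [mC ->]]].
transitivity ((c%:num)%:E * path_law [set s | forall i, (i < n)%N -> C i (s i)])%E; last by [].
rewrite /m1/= /pushforward /mrestr cE path_law_cylinder//.
have -> : path_law [set s : seqspace R | B (s 0%N)] = P (X 0%N @^-1` (phi @^-1` B)).
  by [].
pose D i := if i is j.+1 then C j else B.
rewrite (_ : _ `&` _ = [set s | forall i, (i < n.+1)%N -> D i (s i)]); last first.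
  apply/seteqP; split => s /=.
    by move=> [hC hB] [|i] //= i_n; exact: hC.
  move=> h; split; first by move=> i i_n; exact: (h i.+1).
  exact: (h 0%N).
by rewrite path_law_cylinder ?big_ord_recl//; case.
Qed.

End path.

Lemma ae_negative_sums (phi : T -> R) : measurable_fun setT phi ->
  P.-integrable setT (EFin \o (phi \o X 0%N)) ->
  (\int[P]_w (phi (X 0%N w))%:E < 0)%E ->
  {ae P, forall w, \forall n \near \oo, \sum_(i < n) phi (X i w) < 0}.
Proof.
move=> mphi iphi neg.
have finI := integrable_fin_num measurableT iphi.
(* Half the drift is given away: [phi + e] still has negative mean, so its partial sums are bounded
   by some C, and those of [phi] by C - n e, which is eventually negative. *)
pose e := - fine (\int[P]_w (phi (X 0%N w))%:E) / 2.
have e0 : 0 < e by rewrite divr_gt0// oppr_gt0 fine_lt0// neg andbT -(fineK finI) ltNyr.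
pose psi x := phi x + e.
have mpsi : measurable_fun setT psi by apply: measurable_funD => //; exact: measurable_cst.
have ipsi : P.-integrable setT (EFin \o (psi \o X 0%N)).
  rewrite (_ : _ \o _ = (EFin \o (phi \o X 0%N)) \+ cst e%:E)//.
  by apply: integrableD => //; exact: finite_measure_integrable_cst.
have mc0 : measurable_fun setT (fun s : seqspace R => (s 0%N)%:E).
  by apply/measurable_EFinP; exact: (measurable_coord 0%N).
have iL : (path_law mpsi).-integrable setT (fun s : seqspace R => (s 0%N)%:E).
  apply/integrableP; split => //.
  rewrite /path_law ge0_integral_distribution//; last exact: measurableT_comp.
  by have [_] := integrableP _ _ _ ipsi.
have nL : (\int[path_law mpsi]_s (s 0%N)%:E < 0)%E.
  rewrite /path_law integral_distribution//=.
  under eq_integral do rewrite /path_of/psi EFinD.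
  rewrite integralD//=; last exact: finite_measure_integrable_cst.
  rewrite integral_cst// [X in (_ * X)%E](@probability_setT _ _ _ P) mule1 -(fineK finI) -EFinD lte_fin /e.
  have := neg; rewrite -(fineK finI) lte_fin /=; lra.
have [N [mN N0 NE]] := ae_bounded_partial_sums (path_law_shift_indep mpsi) iL nL.
exists (path_of psi @^-1` N); split.
- by rewrite -[X in measurable X]setTI; exact: measurable_path_of.
- exact: N0.
- move=> w h; apply: NE => -[C hC]; apply: h.
  near=> n.
  have : C < n%:R * e.
    by rewrite -ltr_pdivrMr//; near: n; exact: nbhs_infty_gtr.
  have := hC n; rewrite /path_of /psi big_split/= sumr_const card_ord -mulr_natl.
  lra.
Unshelve. all: by end_near. Qed.

End iid_drift.

(** * Change of density and the strict Jensen inequality *)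

(** The integral of a nonnegative function is a supremum over the simple functions below it, hence
    monotone without measurability. This matters for (KW3), where [sup_density] ranges over an
    uncountable ball. *)
Lemma ge0_le_integral_unmeasurable d (T : measurableType d) (R : realType)
    (mu : {measure set T -> \bar R}) (f1 f2 : T -> \bar R) :
  (forall x, 0 <= f1 x)%E -> (forall x, f1 x <= f2 x)%E ->
  (\int[mu]_x f1 x <= \int[mu]_x f2 x)%E.
Proof.
move=> f10 f12; have f20 x : (0 <= f2 x)%E by exact: le_trans (f12 x).
rewrite !ge0_integralTE//; apply: le_ereal_sup => _ [h /= hf <-].
by exists h => // x; exact: le_trans (hf x) (f12 x).
Qed.

Section density_transfer.
Context d (T : measurableType d) (R : realType).
Context (mu Q : {measure set T -> \bar R}) (h : T -> \bar R).
Local Open Scope ereal_scope.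
Hypotheses (mh : measurable_fun setT h) (h0 : forall x, 0 <= h x).
Hypothesis Qh : forall A, measurable A -> Q A = \int[mu]_(x in A) h x.

Import HBNNSimple.

Lemma integral_density_nnsfun (g : {nnsfun T >-> R}) :
  \int[Q]_x (g x)%:E = \int[mu]_x ((g x)%:E * h x).
Proof.
rewrite integralT_nnsfun sintegralE.
transitivity (\sum_(r \in range g) \int[mu]_x ((r * \1_(g @^-1` [set r]) x)%:E * h x)).
  apply: eq_fsbigr => r rg; rewrite Qh; last exact: measurable_sfunP.
  have r0 : (0 <= r)%R by move: rg; rewrite inE => -[x _ <-].
  under [RHS]eq_integral do rewrite EFinM -muleA.
  rewrite ge0_integralZl//; last 2 first.
  - by apply: emeasurable_funM => //; apply/measurable_EFinP; exact: measurable_indic.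
  - by move=> x _; rewrite mule_ge0// lee_fin.
  congr (_ * _); rewrite integral_mkcond; apply: eq_integral => x _.
  by rewrite epatch_indic muleC.
rewrite -ge0_integral_fsum//; last 2 first.
- move=> r; apply: emeasurable_funM => //; apply/measurable_EFinP.
  by apply: measurable_funM => //; exact: measurable_indic.
- by move=> r x _; rewrite mule_ge0// nnfun_muleindic_ge0.
apply: eq_integral => x _; rewrite [in RHS]fimfunE -fsumEFin// ge0_mule_fsuml//.
by move=> r; rewrite nnfun_muleindic_ge0.
Qed.

(** Monotone convergence from simple functions, on the [Q] side and on the [mu] side. *)
Lemma ge0_integral_density (phi : T -> \bar R) :
  measurable_fun setT phi -> (forall x, 0 <= phi x) ->
  \int[Q]_x phi x = \int[mu]_x (phi x * h x).
Proof.
move=> mphi phi0.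
pose g := nnsfun_approx measurableT mphi.
have cg x : EFin \o g ^~ x @ \oo --> phi x by exact: cvg_nnsfun_approx.
have ndg x : {homo (fun n => (g n x)%:E) : m n / (m <= n)%N >-> m <= n}.
  by move=> m n mn; rewrite lee_fin; exact/lefP/nd_nnsfun_approx.
transitivity (limn (fun n => \int[Q]_x (g n x)%:E)).
  rewrite -monotone_convergence; last 4 first.
  - by [].
  - by move=> n; apply/measurable_EFinP.
  - by move=> n x _; rewrite lee_fin.
  - by move=> x _ m n; exact: ndg.
  by apply: eq_integral => x _; apply/esym/cvg_lim => //; exact: cg.
under eq_fun do rewrite integral_density_nnsfun.
rewrite -monotone_convergence//; last 3 first.
- by move=> n; apply: emeasurable_funM => //; exact/measurable_EFinP.
- by move=> n x _; rewrite mule_ge0// lee_fin.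
- by move=> x _ m n mn; rewrite lee_wpmul2r//; exact: ndg.
apply: eq_integral => x _; apply/cvg_lim => //.
have [hx|] := boolP (h x \is a fin_num).
  by apply: cvgeZr => //; exact: cg.
(* Multiplication by +oo is discontinuous at 0, so the points with [phi x = 0] are separated; there
   every approximant is already 0. *)
rewrite ge0_fin_numE// ltey negbK => /eqP hoo.
have [phix0|phixn0] := eqVneq (phi x) 0.
  have gx0 n : (g n x)%:E = 0.
    apply/eqP; rewrite eq_le; apply/andP; split; last by rewrite lee_fin.
    rewrite -phix0 -(cvg_lim _ (cg x))//.
    apply: lime_ge; first by apply/cvg_ex; exists (phi x); exact: cg.
    by near=> m; apply: ndg; near: m; exists n.
  by under eq_fun do rewrite gx0 mul0e; rewrite phix0 mul0e; exact: cvg_cst.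
rewrite hoo; apply: cvgeM; [|exact: cg|exact: cvg_cst].
by rewrite mule_def_neq0_infty.
Unshelve. all: by end_near. Qed.

End density_transfer.

(** * Truncated log ratios *)

Section log_ratio.
Context d (T : measurableType d) (R : realType) (Q : probability T R).
Implicit Types (a b : T -> R) (c : R).

(** For positive b and c this is ln (a / b) cut off below at ln c, finite even where a vanishes. At
    c = 1 it is the positive part that appears in (KW3). *)
Definition log_ratio c a b x : R := ln (Num.max (a x) (c * b x)) - ln (b x).

Lemma measurable_log_ratio c a b : measurable_fun setT a ->
  measurable_fun setT b -> measurable_fun setT (log_ratio c a b).
Proof.
move=> ma mb; apply: measurable_funB; last exact: measurableT_comp.
apply: measurableT_comp => //; apply: measurable_maxr => //.
exact: measurable_funM.
Qed.

Lemma log_ratio_le c a A b x : 0 < c <= 1 -> 0 < b x -> a x <= A x ->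
  log_ratio c a b x <= log_ratio 1 A b x.
Proof.
move=> /andP[c0 c1] b0 aA; rewrite lerD2r ler_ln ?posrE ?lt_max ?mulr_gt0 ?orbT//.
by rewrite ge_max !le_max aA/= ler_wpM2r ?orbT// ltW.
Qed.

Lemma log_ratio_ge c a b x : 0 < c -> 0 < b x -> ln c <= log_ratio c a b x.
Proof.
move=> c0 b0; rewrite lerBrDr -lnM ?posrE// ler_ln ?posrE ?lt_max ?mulr_gt0 ?orbT//.
by rewrite le_max lexx orbT.
Qed.

(* With q = sqrt (a / b): ln (max (q^2) (e^2)) <= 2 (q + e - 1). *)
Lemma log_ratio_le_sqrt e a b x : 0 < e -> 0 <= a x -> 0 < b x ->
  log_ratio (e ^+ 2) a b x <=
  2 * e - 1 + (a x / b x - (1 - Num.sqrt (a x / b x)) ^+ 2).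
Proof.
move=> e0 a0 b0; rewrite /log_ratio; set q := Num.sqrt _.
have q0 : 0 <= q by exact: sqrtr_ge0.
have qE : q ^+ 2 = a x / b x by rewrite sqr_sqrtr// divr_ge0// ltW.
have -> : a x = q ^+ 2 * b x by rewrite qE divfK// gt_eqF.
have m0 : 0 < Num.max q e by rewrite lt_max e0 orbT.
have -> : Num.max (q ^+ 2 * b x) (e ^+ 2 * b x) = Num.max q e ^+ 2 * b x.
  rewrite -maxr_pMl ?ltW//; congr (_ * _).
  by case: (leP q e) => qe; [rewrite max_r|rewrite max_l]; rewrite ?ler_sqr ?nnegrE//; exact: ltW.
rewrite lnM ?posrE ?exprn_gt0// addrK lnXn// -mulr_natl mulfK ?gt_eqF//.
have lnm : ln (Num.max q e) <= Num.max q e - 1.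
  have := @le_ln1Dx R (Num.max q e - 1).
  by rewrite [1 + _]addrC subrK ltrBrDl subrr; exact.
have mqe : Num.max q e <= q + e by rewrite ge_max lerDl lerDr q0 ltW.
rewrite sqrrB expr1n mul1r -[q *+ 2]mulr_natl.
move: lnm mqe; move: (ln (Num.max q e)) (Num.max q e) (q ^+ 2) => l m q2.
lra.
Qed.

Lemma measurable_ratio a b : measurable_fun setT a -> measurable_fun setT b ->
  (forall x, 0 < b x) -> measurable_fun setT (fun x => a x / b x).
Proof.
move=> ma mb b0; rewrite (_ : (fun x => _) = (fun x => a x * expR (- ln (b x)))).
  apply: measurable_funM => //; apply: measurableT_comp => //.
  by apply: measurableT_comp => //; exact: measurableT_comp.
by apply/funext => x; rewrite expRN lnK// posrE.
Qed.

Section strict.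
Variables (a b A : T -> R) (a_ : nat -> T -> R).
Hypotheses (ma : measurable_fun setT a) (mb : measurable_fun setT b).
Hypotheses (mA : measurable_fun setT A) (ma_ : forall n, measurable_fun setT (a_ n)).
Hypotheses (a0 : forall x, 0 <= a x) (b0 : forall x, 0 < b x).
Hypothesis ab1 : (\int[Q]_x (a x / b x)%:E <= 1)%E.
Hypothesis abN : ~ {ae Q, forall x, a x = b x}.

Let q x := Num.sqrt (a x / b x).

Let mdiv : measurable_fun setT (fun x => a x / b x).
Proof. exact: measurable_ratio. Qed.

Let mq : measurable_fun setT q.
Proof.
apply: measurableT_comp => //; apply: continuous_measurable_fun.
exact: sqrt_continuous.
Qed.

Let div0 x : 0 <= a x / b x. Proof. by rewrite divr_ge0// ltW. Qed.

Let idiv : Q.-integrable setT (fun x => (a x / b x)%:E).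
Proof.
apply/integrableP; split; first exact/measurable_EFinP.
under eq_integral do rewrite gee0_abs ?lee_fin//.
by rewrite (le_lt_trans ab1)// ltry.
Qed.

Let D x := (1 - q x) ^+ 2.

Let mD : measurable_fun setT D.
Proof. by apply: measurable_funX; apply: measurable_funB. Qed.

Let iD : Q.-integrable setT (EFin \o D).
Proof.
have := integrableD measurableT (finite_measure_integrable_cst Q 1 measurableT) idiv.
apply: le_integrable => //; first exact/measurable_EFinP.
move=> x _ /=; rewrite lee_fin !ger0_norm ?addr_ge0 ?sqr_ge0//.
have := sqrtr_ge0 (a x / b x); rewrite -/(q x) => q0.
by rewrite -(sqr_sqrtr (div0 x)) -/(q x) /D; nra.
Qed.

(** A squared Hellinger-type distance: the integrand vanishes exactly where a = b, which by [abN] is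
    not almost everywhere. *)
Lemma integral_sqr_gt0 : (0 < \int[Q]_x (D x)%:E)%E.
Proof.
rewrite lt_neqAle integral_ge0 ?andbT; last by move=> x _; rewrite lee_fin sqr_ge0.
apply/eqP => D0; apply: abN.
have /ae_eq_integral_abs : (\int[Q]_x `|(D x)%:E| = 0)%E.
  by rewrite D0; apply: eq_integral => x _; rewrite gee0_abs// lee_fin sqr_ge0.
move=> /(_ measurableT) []; [exact/measurable_EFinP|move=> N [mN N0 NE]].
exists N; split => // x /= h; apply: NE => /= /(_ I) [] /eqP.
rewrite sqrf_eq0 subr_eq0 => /eqP q1; apply: h.
have := sqr_sqrtr (div0 x); rewrite -/(q x) -q1 expr1n => /esym.
by move/(congr1 (fun z => z * b x)); rewrite divfK ?mul1r// gt_eqF.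
Qed.

Hypothesis aA : forall x, a x <= A x.
Hypothesis aA_ : forall n x, a_ n x <= A x.
Hypothesis a_a : forall x, a_ ^~ x @ \oo --> a x.
Hypothesis Alty : (\int[Q]_x (log_ratio 1 A b x)%:E < +oo)%E.

Let logA0 x : 0 <= log_ratio 1 A b x.
Proof. by rewrite (le_trans _ (log_ratio_ge A ltr01 (b0 x)))// ln1. Qed.

Lemma log_ratio_dominated c a' x : 0 < c <= 1 -> a' x <= A x ->
  `|log_ratio c a' b x| <= - ln c + log_ratio 1 A b x.
Proof.
move=> c01 a'A; have /andP[c0 c1] := c01.
have := log_ratio_le c01 (b0 x) a'A; have := log_ratio_ge a' c0 (b0 x).
have := logA0 x; have : ln c <= 0 by exact: ln_le0.
by rewrite ler_norml => *; apply/andP; split; lra.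
Qed.

Let iA c : Q.-integrable setT (fun x => (- ln c + log_ratio 1 A b x)%:E).
Proof.
rewrite (_ : (fun x => _) = cst (- ln c)%:E \+ (EFin \o log_ratio 1 A b))//.
apply: integrableD => //; first exact: finite_measure_integrable_cst.
apply/integrableP; split; first exact/measurable_EFinP/measurable_log_ratio.
by under eq_integral do rewrite gee0_abs ?lee_fin//.
Qed.

Lemma integrable_log_ratio c a' : 0 < c <= 1 -> measurable_fun setT a' ->
  (forall x, a' x <= A x) -> Q.-integrable setT (EFin \o log_ratio c a' b).
Proof.
move=> c01 ma' a'A; apply: le_integrable (iA c) => //.
  exact/measurable_EFinP/measurable_log_ratio.
move=> x _ /=; rewrite lee_fin (le_trans (log_ratio_dominated c01 (a'A x)))//.
exact: ler_norm.
Qed.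

Lemma integral_log_ratio_lt0 : exists2 c, 0 < c <= 1 &
  (\int[Q]_x (log_ratio c a b x)%:E < 0)%E.
Proof.
have Dfin := integrable_fin_num measurableT iD.
pose k := fine (\int[Q]_x (D x)%:E).
have kE : (\int[Q]_x (D x)%:E = k%:E)%E by rewrite /k fineK.
have k0 : 0 < k by rewrite -lte_fin -kE integral_sqr_gt0.
(* The bound of [log_ratio_le_sqrt] integrates to at most (2 e - 1) + (1 - k) = 2 e - k, and e <= k
   / 4 makes this at most - k / 2. The bound e <= 1 gives c = e^2 <= 1. *)
pose e := Num.min 1 (k / 4).
have e0 : 0 < e by rewrite lt_min ltr01 divr_gt0.
have ek : e <= k / 4 by rewrite ge_min lexx orbT.
have c01 : 0 < e ^+ 2 <= 1.
  by rewrite exprn_gt0//= exprn_ile1 ?(ltW e0)// ge_min lexx.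
exists (e ^+ 2) => //.
have iB : Q.-integrable setT (fun x => (a x / b x)%:E - (D x)%:E)%E by exact: integrableB.
apply: (@le_lt_trans _ _ (\int[Q]_x ((2 * e - 1)%:E + ((a x / b x)%:E - (D x)%:E)))%E).
  apply: le_integral => //.
  - exact: integrable_log_ratio.
  - by apply: integrableD => //; exact: finite_measure_integrable_cst.
  - by move=> x _; rewrite -EFinB -EFinD lee_fin; exact: log_ratio_le_sqrt.
rewrite integralD//; last exact: finite_measure_integrable_cst.
rewrite integral_cst// [X in (_ * X)%E](@probability_setT _ _ _ Q) mule1.
rewrite integralB// kE.
apply: (@le_lt_trans _ _ ((2 * e - 1)%:E + (1 - k%:E))%E).
  by rewrite leeD2l// leeD2r.
by rewrite -EFinB -EFinD lte_fin; lra.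
Qed.

(** With c fixed, [- ln c + log_ratio 1 A b] dominates the log ratios of all [a_ n], so their means
    converge to the negative mean obtained for [a]. *)
Lemma eventually_negative_log_ratio : exists c n, [/\ 0 < c <= 1,
  Q.-integrable setT (EFin \o log_ratio c (a_ n) b) &
  (\int[Q]_x (log_ratio c (a_ n) b x)%:E < 0)%E].
Proof.
have [c c01 neg] := integral_log_ratio_lt0; have /andP[c0 c1] := c01.
have := @dominated_convergence _ _ _ Q setT measurableT
  (fun n x => (log_ratio c (a_ n) b x)%:E) (fun x => (log_ratio c a b x)%:E)
  (fun x => (- ln c + log_ratio 1 A b x)%:E).
move=> [].
- by move=> n; exact/measurable_EFinP/measurable_log_ratio.
- exact/measurable_EFinP/measurable_log_ratio.
- apply/aeW => x _; apply/fine_cvgP; split; first exact: nearW.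
  apply: cvgB; last exact: cvg_cst.
  apply: continuous_cvg; first by apply: continuous_ln; rewrite lt_max mulr_gt0 ?orbT.
  apply: (@continuous_cvg _ _ _ _ _ _ (fun z : R => Num.max z (c * b x))); last exact: a_a.
  apply: (@continuous_max _ _ id (cst (c * b x))); [exact: cvg_id|exact: cvg_cst].
- exact: iA.
- by apply/aeW => x n _; rewrite lee_fin log_ratio_dominated.
move=> _ _ /= cv.
have [n hn] : exists n, (\int[Q]_x (log_ratio c (a_ n) b x)%:E < 0)%E.
  by have [N _ /(_ N (leqnn N))] := cv _ (open_ereal_lt' neg); exists N.
by exists c, n; split => //; exact: integrable_log_ratio.
Qed.

End strict.
End log_ratio.

(** * Compact metric spaces *)

Section compact_metric.
Context (R : realType) (M : metricType R) (I : Type) (emb : I -> M) (i0 : I).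
Hypothesis cM : compact [set: M].

(** Membership in the closure of the range of [emb]. *)
Definition emb_adherent (t : M) : Prop :=
  forall e, 0 < e -> exists i, mdist (emb i) t < e.

Lemma nbhs_mdist_lt (t : M) e : 0 < e -> nbhs t [set y | mdist y t < e].
Proof.
move=> e0; apply/nbhs_ballP; exists e => // y; rewrite ballEmdist/=.
by rewrite metric_sym.
Qed.

Lemma nbhs_mdistW (t : M) (A : set M) : nbhs t A ->
  exists2 e, 0 < e & forall y, mdist y t < e -> A y.
Proof.
move=> /nbhs_ballP[e /= e0 eA]; exists e => // y yt; apply: eA.
by rewrite ballEmdist/= metric_sym.
Qed.

Lemma emb_adherent_cvg (t : M) : emb_adherent t ->
  exists u : nat -> I, emb (u n) @[n --> \oo] --> t.
Proof.
move=> ht; have /choice[u uP] (n : nat) : exists i, mdist (emb i) t < n.+1%:R^-1.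
  by apply: ht.
exists u; apply/cvg_ballP => e e0; near=> n; rewrite ballEmdist/= metric_sym.
apply: lt_trans (uP n) _; near: n; exact: (near_infty_natSinv_lt (PosNum e0)).
Unshelve. all: by end_near. Qed.

(** Without a finite net, the sets of points at distance at least r from a finite set generate a
    proper filter; a cluster point t contradicts the set attached to t alone. *)
Lemma compact_finite_net r : 0 < r ->
  exists D : seq M, forall x, exists2 c, c \in D & mdist c x < r.
Proof.
move=> r0; apply: contrapT => /forallNP noD.
pose far (D : seq M) : set M := [set x | forall c, c \in D -> ~ mdist c x < r].
have FF : ProperFilter (filter_from [set: seq M] far).
  apply: filter_from_proper.
    apply: filter_from_filter; first by exists [::].
    move=> D E _ _; exists (D ++ E) => // x h.
    by split => c cD; apply: h; rewrite mem_cat cD ?orbT.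
  move=> D _; have /existsNP[x hx] := noD D; exists x => c cD cx.
  by apply: hx; exists c.
have [] := cM FF; first by exists [::].
move=> t [_ /(_ (far [:: t]) [set y | mdist y t < r])] [].
- by exists [:: t].
- exact: nbhs_mdist_lt.
- move=> y [/(_ t)]; rewrite inE eqxx => /(_ isT) h /=.
  by rewrite metric_sym.
Qed.

(** Net centres need not be images under [emb], so each centre of a 1/(m+1)-net that has an image
    within that distance is replaced by such an image; the error at most doubles, whence the choice
    of m from e / 2. *)
Lemma emb_dense_sequence : exists p : nat -> I,
  forall i e, 0 < e -> exists n, mdist (emb (p n)) (emb i) < e.
Proof.
have fc (m : nat) : exists D : seq M, forall x, exists2 c, c \in D & mdist c x < m.+1%:R^-1.
  exact: compact_finite_net.
have /choice[D DP] := fc.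
pose sel (m : nat) (c : M) : I :=
  if pselect (exists i, mdist c (emb i) < m.+1%:R^-1) is left h
  then projT1 (cid h) else i0.
exists (fun n => if unpickle n is Some z then sel z.1 (nth (emb i0) (D z.1) z.2) else i0).
move=> i e e0; have e20 : 0 < e / 2 by rewrite divr_gt0.
have [m] := ltr_add_invr e20; rewrite add0r => me.
have [c cD ci] := DP m (emb i).
exists (pickle (m, index c (D m))); rewrite pickleK/= nth_index// /sel.
case: pselect => [h|]; last by case; exists i.
case: (cid h) => j /= cj; rewrite (le_lt_trans (metric_triangle _ c _))//.
by rewrite metric_sym (splitr e) ltrD// (lt_trans _ me).
Qed.

End compact_metric.

(** * Wald's local argument *)

Section wald.
Context (R : realType) (k d : nat) (mu : {measure set (k.-tuple R) -> \bar R}).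
Context (Theta : set (d.-tuple R)) (f : k.-tuple R -> d.-tuple R -> R).
Hypothesis hf : density_family Theta mu f.
Context (Gstar : mixing Theta).
Context (dO : measure_display) (Omega : measurableType dO)
  (P : probability Omega R) (X : nat -> {RV P >-> k.-tuple R}).
Hypothesis hX : iid_sample mu (mix_density f ^~ Gstar) X.
Hypothesis clTheta : closed_tuple Theta.
Hypothesis ctsf : continuous_density (@D_KW R d Theta) (mix_density f).
Context (Gbar : metricType R) (emb : mixing Theta -> Gbar)
  (g : k.-tuple R -> Gbar -> \bar R).
Hypothesis cGbar : compact [set: Gbar].
Hypothesis gE : forall x G, g x (emb G) = mix_density f x G.
Hypothesis ctsg : forall x, continuous (g x).
Hypothesis identg : identifiable_at mu (@mdist R Gbar) g (emb Gstar).
Hypothesis KLg : finite_KL mu (@mdist R Gbar) g (emb Gstar).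
Local Open Scope ereal_scope.

Let h x := mix_density f x Gstar.
Let Q : probability (k.-tuple R) R := distribution P (X 0%N).

Let mh : measurable_fun setT h.
Proof. exact: (measurable_mix_density hf clTheta ctsf). Qed.

Let h0 x : 0 <= h x. Proof. exact: (mix_density_ge0 hf). Qed.

Let Qh A : measurable A -> Q A = \int[mu]_(x in A) h x.
Proof. by move=> mA; case: hX => + _; exact. Qed.

Let inth1 : \int[mu]_x h x = 1.
Proof. by rewrite -Qh// probability_setT. Qed.

Section adherent.
Variable t : Gbar.
Hypothesis adt : emb_adherent emb t.

Lemma adherent_cvg : exists u : nat -> mixing Theta,
  forall x, mix_density f x (u n) @[n --> \oo] --> g x t.
Proof.
have [u ut] := emb_adherent_cvg adt.
exists u => x; rewrite (_ : (fun n => _) = g x \o (fun n => emb (u n))).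
  by apply: cvg_comp ut _; exact: ctsg.
by apply/funext => n /=; rewrite gE.
Qed.

Lemma adherent_ge0 x : 0 <= g x t.
Proof.
have [u ut] := adherent_cvg; rewrite -(cvg_lim _ (ut x))//.
apply: lime_ge; first by apply/cvg_ex; exists (g x t); exact: ut.
by apply: nearW => n; exact: (mix_density_ge0 hf).
Qed.

Lemma adherent_measurable : measurable_fun setT (g ^~ t).
Proof.
have [u ut] := adherent_cvg.
apply: (emeasurable_fun_cvg (fun n x => mix_density f x (u n))).
  by move=> n; exact: (measurable_mix_density hf clTheta ctsf (u n)).
by move=> x _; exact: ut.
Qed.

Lemma adherent_integral_le1 : \int[mu]_x g x t <= 1.
Proof.
have [u ut] := adherent_cvg.
have -> : \int[mu]_x g x t = \int[mu]_x limn_einf (fun n => mix_density f x (u n)).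
  by apply: eq_integral => x _; rewrite (cvg_limn_einf_sup (ut x)).1.
apply: le_trans (fatou mu measurableT _ _) _ => //.
- by move=> n; exact: (measurable_mix_density hf clTheta ctsf (u n)).
- by move=> n x _; exact: (mix_density_ge0 hf).
- rewrite limn_einf_lim; apply: lime_le; first exact: is_cvg_einfs.
  apply: nearW => n; apply: le_trans (ereal_inf_lbound _) _; first by exists n => /=.
  exact: (integral_mix_density_le1 hf clTheta ctsf).
Qed.

(* If g(., t) = h almost surely under the true law, then all the mass of h, hence
   (total mass at most 1) all that of g(., t), sits on [g(., t) = h]. *)
Lemma ae_eq_identified : {ae Q, forall x, g x t = h x} -> mdist t (emb Gstar) = 0%R.
Proof.
move=> [N [mN N0 NE]]; apply: identg => x0.
have mg := adherent_measurable; have g0 := adherent_ge0.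
have mNC : measurable (~` N) by exact: measurableC.
have gh x : (~` N) x -> g x t = h x.
  by move=> Nx; apply: contrapT => gh; apply: Nx; exact: NE.
have splitN (u : k.-tuple R -> \bar R) B : measurable B -> measurable_fun setT u ->
    (forall x, 0 <= u x) ->
    \int[mu]_(x in B) u x = \int[mu]_(x in B `&` ~` N) u x + \int[mu]_(x in B `&` N) u x.
  move=> mB mu_ u0; rewrite -ge0_integral_setU//.
  - by rewrite -setIUr setUC setUv setIT.
  - exact: measurableI.
  - exact: measurableI.
  - exact: measurable_funTS.
  - by apply/disj_setPLR => x [_ Nx] [].
have hN B : measurable B -> \int[mu]_(x in B `&` N) h x = 0.
  move=> mB; apply/eqP; rewrite eq_le integral_ge0 ?andbT//.
  rewrite -N0 Qh//; apply: ge0_subset_integral => //; first exact: measurableI.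
  exact: measurable_funTS.
have gC B : measurable B -> \int[mu]_(x in B `&` ~` N) g x t = \int[mu]_(x in B) h x.
  move=> mB; rewrite (splitN h)// hN// adde0; apply: eq_integral => x.
  by rewrite inE => -[_ Nx]; exact: gh.
have gN : \int[mu]_(x in N) g x t = 0.
  have := adherent_integral_le1; rewrite (splitN (g ^~ t))// gC// inth1 setTI.
  rewrite -[leRHS]adde0 leeD2lE// => gN; apply/eqP.
  by rewrite eq_le gN/= integral_ge0.
rewrite /density_cdf.
under [RHS]eq_integral do rewrite gE -/(h _).
have mo := measurable_orthant x0.
rewrite (splitN (g ^~ t))// gC// -[RHS]adde0; congr (_ + _).
apply/eqP; rewrite eq_le integral_ge0 ?andbT//.
rewrite -gN; apply: ge0_subset_integral => //; first exact: measurableI.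
exact: measurable_funTS.
Qed.

End adherent.

Section local_supremum.
Variable p : nat -> mixing Theta.
Hypothesis pdense : forall G e, (0 < e)%R ->
  exists n, (mdist (emb (p n)) (emb G) < e)%R.
Variable t : Gbar.
Hypothesis adt : emb_adherent emb t.

(** The centre occupies index 0 and stands in for every [p n'] outside the ball, so the supremum
    always dominates [g x t]. *)
Definition nearby_density (r : R) x (n : nat) : \bar R :=
  if n is n'.+1 then
    if (mdist (emb (p n')) t < r)%R then mix_density f x (p n') else g x t
  else g x t.

(* A countable, hence measurable, version of the supremum of g(x, .) over the
   elements of the ball of centre t and radius r that are mixing distributions. *)
Definition local_sup (r : R) x : \bar R := esups (nearby_density r x) 0%N.

Lemma local_sup_ubound r x n : nearby_density r x n <= local_sup r x.
Proof. by apply: ereal_sup_ubound; exists n. Qed.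

Lemma local_sup_lub r x z : (forall n, nearby_density r x n <= z) -> local_sup r x <= z.
Proof. by move=> h'; apply: ge_ereal_sup => _ [n _ <-]. Qed.

Lemma local_sup_center r x : g x t <= local_sup r x.
Proof. exact: (local_sup_ubound r x 0). Qed.

Lemma local_sup_ge0 r x : 0 <= local_sup r x.
Proof. exact: le_trans (adherent_ge0 adt x) (local_sup_center r x). Qed.

Lemma measurable_local_sup r : measurable_fun setT (local_sup r).
Proof.
have mn n : measurable_fun setT (nearby_density r ^~ n); last first.
  exact: (@measurable_fun_esups _ _ _ setT (fun n x => nearby_density r x n) mn 0%N).
have mgt := adherent_measurable adt.
case: n => [|n] //=; case: (mdist _ _ < r)%R => //.
exact: (measurable_mix_density hf clTheta ctsf).
Qed.

(** If g(x, .) exceeded the countable supremum at [emb G], by continuity it would exceed it on a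
    neighbourhood, which contains some [emb (p n)] still inside the ball. *)
Lemma local_sup_emb r x G : (mdist (emb G) t < r)%R ->
  mix_density f x G <= local_sup r x.
Proof.
move=> Gt; rewrite leNgt; apply/negP; rewrite -gE => lt.
have /nbhs_mdistW[e e0 eP] : nbhs (emb G) [set y | local_sup r x < g x y].
  exact: ctsg (open_ereal_gt' lt).
have e'0 : (0 < Num.min e (r - mdist (emb G) t))%R by rewrite lt_min e0 subr_gt0.
have [n] := pdense G e'0; rewrite lt_min => /andP[ne nr].
have := eP _ ne; rewrite /= ltNge => /negP; apply.
have := local_sup_ubound r x n.+1; rewrite /= -gE ifT//.
by rewrite (le_lt_trans (metric_triangle _ (emb G) _))// -ltrBrDr.
Qed.

Lemma local_sup_homo r r' x : (r <= r')%R -> local_sup r x <= local_sup r' x.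
Proof.
move=> rr'; apply: local_sup_lub => -[|n] /=; first exact: local_sup_center.
case: ifPn => [nr|_]; last exact: local_sup_center.
by have := local_sup_ubound r' x n.+1; rewrite /= ifT// (lt_le_trans nr).
Qed.

Lemma local_sup_le_sup_density r x : (0 < r)%R ->
  local_sup r x <= sup_density g x (dist_ball (@mdist R Gbar) t r).
Proof.
move=> r0; have gt : g x t <= sup_density g x (dist_ball (@mdist R Gbar) t r).
  by apply: ereal_sup_ubound; exists t => //; rewrite /dist_ball/= mdistxx.
apply: local_sup_lub => -[|n] //=; case: ifPn => // nr.
by apply: ereal_sup_ubound; exists (emb (p n)).
Qed.

(** Continuity of g(x, .) at [t] caps the values on small balls by g(x, t) + e, and the centre gives
    the lower bound. Finiteness at radius r lets all values be compared as reals. *)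
Lemma cvg_local_sup r x : (0 < r)%R -> local_sup r x < +oo ->
  fine (local_sup (r / n.+1%:R) x) @[n --> \oo] --> fine (g x t).
Proof.
move=> r0 lty.
have rn n : (r / n.+1%:R <= r)%R.
  by rewrite ler_pdivrMr// ler_peMr ?ler1n// ltW.
have sfin n : local_sup (r / n.+1%:R) x \is a fin_num.
  rewrite ge0_fin_numE ?local_sup_ge0// (le_lt_trans _ lty)//.
  exact: local_sup_homo.
have gfin : g x t \is a fin_num.
  rewrite ge0_fin_numE ?adherent_ge0// (le_lt_trans _ lty)//.
  exact: local_sup_center.
apply/cvgrPdist_le => e e0.
have ge : g x t < (fine (g x t) + e)%:E.
  by rewrite -[ltLHS]fineK// lte_fin ltrDl.
have /nbhs_mdistW[del del0 delP] : nbhs t [set y | g x y < (fine (g x t) + e)%:E].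
  exact: ctsg (open_ereal_lt' ge).
near=> n.
have nd : (r / n.+1%:R < del)%R.
  rewrite -ltr_pdivlMl// mulrC; near: n.
  have rd0 : (0 < r^-1 * del)%R by rewrite mulr_gt0// invr_gt0.
  by near do rewrite mulrC; exact: (near_infty_natSinv_lt (PosNum rd0)).
rewrite distrC ger0_norm ?subr_ge0 ?fine_le ?local_sup_center//.
rewrite lerBlDl -lee_fin fineK//; apply: local_sup_lub => -[|m] /=.
  exact: ltW.
case: ifPn => mr; last exact: ltW.
by rewrite -gE; apply/ltW/delP; exact: lt_trans mr nd.
Unshelve. all: by end_near. Qed.

End local_supremum.

Lemma ae_density_gt0 : {ae Q, forall x, 0 < h x}.
Proof.
have mA : measurable [set x | 0 < h x].
  by rewrite -[X in measurable X]setTI; exact: emeasurable_fun_o_infty.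
exists (~` [set x | 0 < h x]); split => //; first exact: measurableC.
rewrite Qh; last exact: measurableC.
by apply: integral0_eq => x /= /negP; rewrite -leNgt => hx; apply/eqP; rewrite eq_le hx h0.
Qed.

Lemma ae_density_lty : {ae Q, forall x, h x < +oo}.
Proof.
have ih : mu.-integrable setT h.
  apply/integrableP; split => //.
  by under eq_integral do rewrite gee0_abs//; rewrite inth1 ltry.
have [N [mN N0 NE]] := integrable_ae measurableT ih.
exists N; split => //.
  by rewrite Qh//; apply: null_set_integral => //; exact: measurable_funTS.
move=> x /= hx; apply: NE => /= /(_ I); rewrite ge0_fin_numE//; exact: hx.
Qed.

(** Where 0 < h < +oo and the supremum is infinite, the integrand of (KW3) is +oo; this set is
    therefore [mu]-null, hence [Q]-null. *)
Lemma ae_local_sup_lty p t r : emb_adherent emb t -> (0 < r)%R ->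
  expect_star mu g (emb Gstar) (fun x => lne (sup_density g x
    (dist_ball (@mdist R Gbar) t r) / g x (emb Gstar)))^\+ < +oo ->
  {ae Q, forall x, local_sup p t r x < +oo}.
Proof.
move=> adt r0 KL.
pose N := [set x | 0 < h x] `&` [set x | h x < +oo] `&` [set x | +oo <= local_sup p t r x].
have mS : measurable_fun setT (local_sup p t r) by exact: measurable_local_sup.
have mN : measurable N.
  apply: measurableI; first apply: measurableI.
  - by rewrite -[X in measurable X]setTI; exact: emeasurable_fun_o_infty.
  - by rewrite -[X in measurable X]setTI; exact: emeasurable_fun_infty_o.
  - by rewrite -[X in measurable X]setTI; exact: emeasurable_fun_c_infty.
have muN : mu N = 0.
  apply: contra_ltP KL => /eqP; rewrite -measure_gt0 => muN.
  apply: (@le_trans _ _ (\int[mu]_(x in N) cst +oo x)).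
    by rewrite integral_cst// gt0_mulye.
  rewrite integral_mkcond; apply: ge0_le_integral_unmeasurable.
    by move=> x; apply: erestrict_ge0 => // y _; rewrite leey.
  move=> x; rewrite patchE funeposE gE -/(h x); case: ifPn => [|_]; last first.
    by rewrite mule_ge0// le_max lexx orbT.
  rewrite inE => -[[/= hx0 hxoo] Soo].
  have -> : sup_density g x (dist_ball (@mdist R Gbar) t r) = +oo.
    by apply/eqP; rewrite -leye_eq (le_trans Soo)// local_sup_le_sup_density.
  move: hx0 hxoo; case: (h x) => [b| |]//; rewrite lte_fin => b0 _.
  rewrite inver gt_eqF// gt0_mulye ?lte_fin ?invr_gt0//=.
  by rewrite max_l ?leey// gt0_mulye.
have QN : {ae Q, forall x, ~ N x}.
  exists N; split => //; last by move=> x /= /contrapT.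
  by rewrite Qh//; apply: null_set_integral => //; exact: measurable_funTS.
apply: filterS3 ae_density_gt0 ae_density_lty QN => x hx0 hxoo Nx.
by rewrite ltNge; apply/negP => Soo; exact: Nx.
Qed.

Lemma wald_local t : emb_adherent emb t -> mdist t (emb Gstar) <> 0%R ->
  exists2 r, (0 < r)%R & {ae P, forall w, \forall n \near \oo,
    forall G, (mdist (emb G) t < r)%R ->
    log_likelihood f n (fun i => X i w) G <
    log_likelihood f n (fun i => X i w) Gstar}.
Proof.
move=> adt tN; have [p pdense] := emb_dense_sequence emb Gstar cGbar.
have [r0 r00 KL] := KLg tN.
pose S := local_sup p t.
pose rn n : R := (r0 / n.+1%:R)%R.
have rn0 n : (0 < rn n)%R by rewrite divr_gt0.
have rnr n : (rn n <= r0)%R by rewrite ler_pdivrMr// ler_peMr ?ler1n// ltW.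
have mS r : measurable_fun setT (S r) by exact: measurable_local_sup.
have mg := adherent_measurable adt.
have Qall : {ae Q, forall x, [/\ 0 < h x, h x < +oo & S r0 x < +oo]}.
  by apply: filterS3 ae_density_gt0 ae_density_lty (ae_local_sup_lty p adt r00 KL).
pose good := [set x | 0 < h x] `&` [set x | h x < +oo] `&` [set x | S r0 x < +oo].
have mgood : measurable good.
  apply: measurableI; first apply: measurableI.
  - by rewrite -[X in measurable X]setTI; exact: emeasurable_fun_o_infty.
  - by rewrite -[X in measurable X]setTI; exact: emeasurable_fun_infty_o.
  - by rewrite -[X in measurable X]setTI; exact: emeasurable_fun_infty_o.
have Qgood : {ae Q, forall x, good x} by apply: filterS Qall => x [].
(* With the common value 1 off the almost sure set [good], the pointwise hypotheses on a, b, A and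
   [a_] hold everywhere, and the log ratios with c <= 1 are 0 there. *)
pose patched (u : k.-tuple R -> \bar R) x : R := if x \in good then fine (u x) else 1%R.
have mgoodb : measurable_fun setT (fun x => x \in good).
  apply: (@measurable_fun_bool _ _ _ _ true); rewrite setTI.
  by rewrite (_ : _ @^-1` _ = good)//; apply/seteqP; split => x /=; [exact: set_mem|exact: mem_set].
have mpatched u : measurable_fun setT u -> measurable_fun setT (patched u).
  by move=> mu'; apply: measurable_fun_ifT => //; exact: measurableT_comp.
have patchedE u x : good x -> 0 <= u x -> u x < +oo -> u x = (patched u x)%:E.
  by move=> gx u0 uoo; rewrite /patched mem_set// fineK// ge0_fin_numE.
have patchedN u x : ~ good x -> patched u x = 1%R.
  by move=> gx; rewrite /patched memNset.
have S0 r x : 0 <= S r x by exact: local_sup_ge0.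
have Slty n x : good x -> S (rn n) x < +oo.
  by move=> [_ Soo]; apply: le_lt_trans Soo; exact: local_sup_homo.
have glty x : good x -> g x t < +oo.
  by move=> [_ Soo]; apply: le_lt_trans Soo; exact: local_sup_center.
have hE x : good x -> h x = (patched h x)%:E by move=> gx; case: (gx) => [[_ hoo] _]; exact: patchedE.
have gtE x : good x -> g x t = (patched (g ^~ t) x)%:E.
  by move=> gx; apply: patchedE => //; [exact: adherent_ge0|exact: glty].
have SE n x : good x -> S (rn n) x = (patched (S (rn n)) x)%:E.
  by move=> gx; apply: patchedE => //; exact: Slty.
have S0E x : good x -> S r0 x = (patched (S r0) x)%:E.
  by move=> gx; case: (gx) => _ Soo; exact: patchedE.
set a := patched (g ^~ t) in gtE; set b := patched h in hE.
set A := patched (S r0) in S0E; pose a_ n := patched (S (rn n)).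
have a0 x : (0 <= a x)%R.
  have [gx|gx] := pselect (good x); last by rewrite /a patchedN.
  by rewrite -lee_fin -gtE//; exact: adherent_ge0.
have b0 x : (0 < b x)%R.
  have [gx|gx] := pselect (good x); last by rewrite /b patchedN.
  by rewrite -lte_fin -hE//; case: gx => [[]].
have aA x : (a x <= A x)%R.
  have [gx|gx] := pselect (good x); last by rewrite /a /A !patchedN.
  by rewrite -lee_fin -gtE// -S0E//; exact: local_sup_center.
have a_A n x : (a_ n x <= A x)%R.
  have [gx|gx] := pselect (good x); last by rewrite /a_ /A !patchedN.
  by rewrite -lee_fin -SE// -S0E//; exact: local_sup_homo.
have a_a x : (a_ ^~ x @ \oo --> a x)%R.
  have [gx|gx] := pselect (good x); last first.
    by rewrite /a patchedN//; apply: cvg_near_cst; apply: nearW => n; rewrite /a_ patchedN.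
  rewrite /a /a_ /patched mem_set//; apply: cvg_local_sup => //.
  by case: gx.
have ma : measurable_fun setT a by exact: mpatched.
have mb : measurable_fun setT b by exact: mpatched.
have mA : measurable_fun setT A by exact: mpatched.
have ma_ n : measurable_fun setT (a_ n) by exact: mpatched.
have mab := measurable_ratio ma mb b0.
have ab1 : \int[Q]_x (a x / b x)%:E <= 1.
  (* Off [good] the ratio is 1 and its product with h may exceed g(., t); replacing it by 0 there
     changes nothing [Q]-almost everywhere and gives u h <= g(., t) everywhere. *)
  pose u x := if x \in good then (a x / b x)%:E else 0.
  have mu' : measurable_fun setT u.
    by apply: measurable_fun_ifT => //; exact/measurable_EFinP.
  have u0 x : 0 <= u x by rewrite /u; case: ifP => // _; rewrite lee_fin divr_ge0// ltW.
  rewrite (@ge0_ae_eq_integral _ _ _ _ _ _ u)//; last 3 first.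
  - exact/measurable_EFinP.
  - by move=> x _; rewrite lee_fin divr_ge0// ltW.
  - by apply: filterS Qgood => x gx _; rewrite /u mem_set.
  rewrite (ge0_integral_density mh h0 Qh)//.
  apply: le_trans (adherent_integral_le1 adt).
  apply: ge0_le_integral_unmeasurable => x; first by rewrite mule_ge0.
  rewrite /u; case: ifPn => [|_]; last by rewrite mul0e adherent_ge0.
  by rewrite inE => gx; rewrite hE// gtE// -EFinM divfK ?gt_eqF.
have abN : ~ {ae Q, forall x, a x = b x}.
  move=> ab; apply: tN; apply: ae_eq_identified => //.
  by apply: filterS2 Qgood ab => x gx abx; rewrite gtE// hE// abx.
have logA0 x : (0 <= log_ratio 1 A b x)%R.
  by rewrite (le_trans _ (log_ratio_ge A ltr01 (b0 x)))// ln1.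
have Alty : \int[Q]_x (log_ratio 1 A b x)%:E < +oo.
  rewrite (ge0_integral_density mh h0 Qh)//; last first.
    exact/measurable_EFinP/measurable_log_ratio.
  apply: le_lt_trans KL; apply: ge0_le_integral_unmeasurable => x.
    by rewrite mule_ge0// lee_fin.
  rewrite funeposE gE -/(h x).
  have [gx|gx] := pselect (good x); last first.
    rewrite /log_ratio /A /b !patchedN// mul1r max_l// subrr mul0e.
    by rewrite mule_ge0// le_max lexx orbT.
  rewrite lee_wpmul2r// hE// le_max.
  (* Either the log ratio is 0, below any positive part, or the truncation at b is inactive and A is
     compared with the full supremum over the ball. *)
  have [Ab|bA] := leP (A x) (b x).
    by rewrite /log_ratio mul1r max_r// subrr lexx orbT.
  apply/orP; left; rewrite /log_ratio mul1r max_l; last exact: ltW.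
  have A0 : (0 < A x)%R by exact: lt_trans (b0 x) bA.
  rewrite -ln_div ?posrE// -lne_EFin ?divr_gt0//.
  have le : (A x / b x)%:E <= sup_density g x (dist_ball (@mdist R Gbar) t r0) / (b x)%:E.
    rewrite inver gt_eqF// EFinM lee_wpmul2r ?lee_fin ?invr_ge0 ?(ltW (b0 x))//.
    by rewrite -S0E//; exact: local_sup_le_sup_density.
  have ge0 : 0 <= (A x / b x)%:E by rewrite lee_fin divr_ge0// ltW.
  by rewrite lee_lne// in_itv/= leey andbT// (le_trans ge0).
have [c [n [/andP[c0 c1] ilr neg]]] :=
  eventually_negative_log_ratio ma mb mA ma_ a0 b0 ab1 abN aA a_A a_a Alty.
pose phi := log_ratio c (a_ n) b.
have mphi : measurable_fun setT phi by exact: measurable_log_ratio.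
exists (rn n) => //.
have iphi : P.-integrable setT (EFin \o (phi \o X 0%N)).
  apply/integrableP; split.
    by apply/measurable_EFinP; exact: measurableT_comp.
  have [_] := integrableP _ _ _ ilr; rewrite ge0_integral_distribution//.
  by apply: measurableT_comp => //; exact/measurable_EFinP.
have nphi : \int[P]_w (phi (X 0%N w))%:E < 0.
  by move: neg; rewrite integral_distribution//; exact/measurable_EFinP.
have Xsame i B : measurable B -> P (X i @^-1` B) = P (X 0%N @^-1` B).
  by move=> mB; case: hX => hX1 _; rewrite !hX1.
have sums := ae_negative_sums Xsame (proj2 hX) mphi iphi nphi.
have Xgood : {ae P, forall w i, good (X i w)}.
  apply: ae_foralln => i; have [N [mN N0 NE]] := Qgood.
  exists (X i @^-1` N); split.
  - by rewrite -[X in measurable X]setTI; exact: measurable_funP.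
  - by transitivity (\int[mu]_(x in N) h x); [exact: (proj1 hX)|rewrite -Qh].
  - by move=> w /= nw; apply: NE.
apply: filterS2 sums Xgood => w sw gw; apply: filterS sw => m sm G Gt.
rewrite /log_likelihood.
(* The right side is ln (max (a_n) (c b)), and [a_ n] dominates the density of every [G] in the
   ball: one bound serves all these [G], and the event does not depend on [G]. *)
have lnG (i : 'I_m) : lne (mix_density f (X i w) G) <= (phi (X i w) + ln (b (X i w)))%:E.
  rewrite /phi /log_ratio subrK.
  have m0 : (0 < Num.max (a_ n (X i w)) (c * b (X i w)))%R by rewrite lt_max mulr_gt0 ?orbT.
  have G0 : 0 <= mix_density f (X i w) G by exact: (mix_density_ge0 hf).
  rewrite -lne_EFin// lee_lne ?in_itv/= ?leey ?andbT ?lee_fin ?(ltW m0)//.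
  rewrite (le_trans (local_sup_emb pdense _ Gt))// -/(S (rn n) _) SE// lee_fin.
  by rewrite le_max lexx.
apply: le_lt_trans (lee_sum _ (fun i _ => lnG i)) _.
under [ltRHS]eq_bigr do rewrite -/(h _) hE// lne_EFin//.
by rewrite !sumEFin lte_fin big_split/= gtrDr.
Qed.

End wald.

(** * From local bounds to consistency by compactness *)

Theorem theorem2p2 (R : realType) (k d : nat)
    (mu : {measure set (k.-tuple R) -> \bar R})
    (Theta : set (d.-tuple R)) (f : k.-tuple R -> d.-tuple R -> R)
    (hf : density_family Theta mu f)
    (Gstar : mixing Theta)
    (dO : measure_display) (Omega : measurableType dO)
    (P : probability Omega R) (X : nat -> {RV P >-> k.-tuple R})
    (hX : iid_sample mu (mix_density f ^~ Gstar) X)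
    (KW1 : identifiable_at mu (@D_KW R d Theta) (mix_density f) Gstar)
    (KW2 : closed_tuple Theta /\
           continuous_density (@D_KW R d Theta) (mix_density f))
    (KW3 : finite_KL mu (@D_KW R d Theta) (mix_density f) Gstar)
    (KW4 : compact_extension mu f Gstar)
    (Ghat : nat -> Omega -> mixing Theta)
    (hGhat : {ae P, forall w, forall n, is_NPMLE f n (fun i => X i w) (Ghat n w)}) :
  {ae P, forall w, D_KW (Ghat n w) Gstar @[n --> \oo] --> (0 : R)}.
Proof.
have [clTheta ctsf] := KW2.
have [Gbar [emb [g [cGbar embD gE ctsg [identg KLg]]]]] := KW4.
have avoid t : mdist t (emb Gstar) <> 0 -> exists2 r, 0 < r &
    {ae P, forall w, \forall n \near \oo, ~ mdist (emb (Ghat n w)) t < r}.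
  move=> tN; have [adt|/existsNP[r /not_implyP[r0 noG]]] := pselect (emb_adherent emb t).
    have [r r0 ll] := wald_local hf hX clTheta ctsf cGbar gE ctsg identg KLg adt tN.
    exists r => //; apply: filterS2 hGhat ll => w mle; apply: filterS => n lt rG.
    have := lt _ rG; rewrite ltNge => /negP; apply.
    by rewrite (mle n); apply: ereal_sup_ubound; exists Gstar.
  (* A ball around a non-adherent point contains no mixing distribution, in particular no value of
     the NPMLE. *)
  exists r => //; apply/aeW => w; apply: nearW => n rG; apply: noG.
  by exists (Ghat n w).
have close e : 0 < e ->
    {ae P, forall w, \forall n \near \oo, mdist (emb (Ghat n w)) (emb Gstar) < e}.
  move=> e0; apply: contrapT => far.
  (* With the almost sure and eventual quantifiers inside the filter, no finite subcover has to be
     extracted: [F] is proper exactly because the claim is assumed to fail, and a cluster point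
     contradicts [avoid], or the clause on [e] if it is [emb Gstar]. *)
  pose F : set_system Gbar := [set A | {ae P, forall w, \forall n \near \oo,
    A (emb (Ghat n w)) \/ mdist (emb (Ghat n w)) (emb Gstar) < e}].
  have FF : Filter F.
    split.
    - by rewrite /F /mkset; apply/aeW => w; apply: nearW => n; left.
    - rewrite /F /mkset => A B FA FB; apply: filterS2 FA FB => w; apply: filterS2 => n [] An [] Bn.
      + by left.
      + by right.
      + by right.
      + by right.
    - by rewrite /F /mkset => A B AB; apply: filterS => w; apply: filterS => n [/AB|]; [left|right].
  have PF : ProperFilter F.
    split; last exact: FF.
    by rewrite /F /mkset => F0; apply: far; apply: filterS F0 => w; apply: filterS => n [].
  have [t [_ ct]] := cGbar F PF filterT.
  have [t0|tN] := eqVneq (mdist t (emb Gstar)) 0.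
    have tE := mdist_positivity _ _ t0.
    have [] := ct [set y | ~ mdist y t < e] [set y | mdist y t < e].
    - rewrite /F /mkset; apply/aeW => w; apply: nearW => n; rewrite tE.
      by have [] := pselect (mdist (emb (Ghat n w)) (emb Gstar) < e); [right|left].
    - exact: nbhs_mdist_lt.
    - by move=> y [].
  have [r r0 av] := avoid t (elimN eqP tN).
  have [] := ct [set y | ~ mdist y t < r] [set y | mdist y t < r].
  - by rewrite /F /mkset; apply: filterS av => w; apply: filterS => n nr; left.
  - exact: nbhs_mdist_lt.
  - by move=> y [].
(* Countably many radii give one null set that serves all of them. *)
have : {ae P, forall w (m : nat), \forall n \near \oo,
    mdist (emb (Ghat n w)) (emb Gstar) < m.+1%:R^-1}.
  by apply: ae_foralln => m; exact: close.
apply: filterS => w hw; apply/cvgrPdist_lt => e e0.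
have [m] := ltr_add_invr e0; rewrite add0r => me.
apply: filterS (hw m) => n; rewrite embD sub0r normrN => hn.
by rewrite ger0_norm -?embD ?mdist_ge0// embD (lt_trans hn).
Qed.
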